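(* For each of the following three hypotheses there exist a separable Hilbert space $\mathcal H$, a domain $\mathcal D\subset\mathbb C$ containing $0$ and a holomorphic function $A:\mathcal D\to\mathcal L(\mathcal H)$ such that the other two hypotheses hold, the chosen hypothesis does not hold, the function $F(z)=I-A(z)/z$ is Fredholm at each point of $\mathcal D\setminus\{0\}$ and $F(z_0)$ is invertible for some $z_0\in\mathcal D\setminus\{0\}$, and yet both conclusions (C1) and (C2) (stated in the context) are false: (i) $A(z)$ is compact-valued; (ii) $A(0)$ is selfadjoint; (iii) $I-A'(0)\Pi_0$ is invertible.
   Context: $\mathcal L(\mathcal H)$ is the space of bounded operators on $\mathcal H$; $\Pi_0$ is the orthogonal projection onto $\ker A(0)$; $A'(0)$ is the derivative of $A$ at $0$. $F$ Fredholm at $w$ (for $F$ holomorphic near $w$) means that $F(w)$ is a Fredholm operator. Characteristic values of $F(z)=I-A(z)/z$ are the points $w\in\mathcal D\setminus\{0\}$ where $F(w)$ is not invertible; when $F$ is Fredholm on $\mathcal D\setminus\{0\}$ and invertible at some point they form a discrete closed subset of $\mathcal D\setminus\{0\}$, and the multiplicity of $w$ is $\frac1{2i\pi}\operatorname{tr}\int_{|z-w|=\rho}F'(z)F(z)^{-1}dz$ for $\rho>0$ small. $\mathcal N(\Omega)$ is the number of characteristic values in $\Omega\setminus\{0\}$ counted with multiplicities. $n(\Lambda)$, $\Lambda\subset\mathbb R$, is the number of eigenvalues of $A(0)$ in $\Lambda$ counted with multiplicities ($=\operatorname{tr}\mathbf 1_\Lambda(A(0))$ when $A(0)$ is selfadjoint;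 algebraic multiplicities otherwise). $\mathcal C_\theta(a,b)=\{x+iy:\ a\le x\le b,\ |y|\le\theta|x|\}$. (C1) For every bounded domain $\Omega$ with $\overline\Omega\subset\mathbb C\setminus\{0\}$ compact and with smooth boundary transverse to the real axis at each point of $\partial\Omega\cap\mathbb R$, setting $J=\Omega\cap\mathbb R$ and $I_\delta=(\partial\Omega\cap\mathbb R)+[-\delta,\delta]$: there exist $C,\delta_1>0$ such that for all $0<\delta<\delta_1$ there is $s(\delta)>0$ such that $|\mathcal N(s\Omega)-n(sJ)|\le C\,n(sI_\delta)|\ln\delta|^2$ for all $0<s<s(\delta)$. (C2) For every $\theta>0$ with $\mathcal C_\theta(r,1)\subset\mathcal D$ for all $0<r<1$: there exist $C,\delta_1>0$ such that for all $0<\delta<\delta_1$ there are $r(\delta)>0$ and $C_\delta>0$ such that for all $0<r<r(\delta)$, $|\mathcal N(\mathcal C_\theta(r,1))-n([r,1])|\le C\delta|\ln\delta|^2n([r,1])+C|\ln\delta|^2n([r(1-\delta),r(1+\delta)])+C_\delta$. When (i), (ii), (iii) all hold, (C1) and (C2) are theorems. *)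

(* Defs.v *)
From HB Require Import structures.
From mathcomp Require Import all_boot all_order all_algebra.
From mathcomp Require Import complex.
From mathcomp Require Import all_classical all_reals all_analysis.

Set Implicit Arguments.
Unset Strict Implicit.
Unset Printing Implicit Defensive.

Import Order.TTheory GRing.Theory Num.Theory.
Import numFieldNormedType.Exports.

Local Open Scope classical_set_scope.
Local Open Scope ring_scope.
Local Open Scope complex_scope.

(* The norm and the order of R[i] take values in R[i]: for complex a and b,
   a <= b means that b - a is a nonnegative real. *)
HB.instance Definition _ (R : rcfType) := NormedModule.copy R[i] R[i]^o.

(* The form is linear in its first argument. *)
Record hilbertSpace (R : realType) := HilbertSpace {
  hcarrier :> completeNormedModType R[i];
  hdot : {dot hcarrier for Num.conj};
  hdotE : forall x : hcarrier, `|x| ^+ 2 = hdot x x }.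

Section Operators.
Variables (R : realType) (H : hilbertSpace R).
Implicit Types (T S : H -> H) (V : set H) (x y : H).

Definition separable := exists2 E : set H, countable E & dense E.

Definition bounded_operator T :=
  linear T /\ exists M : R, forall x, `|T x| <= M%:C * `|x|.

Definition compact_operator T := precompact (T @` [set x | `|x| <= 1]).

Definition selfadjoint T := forall x y, hdot H (T x) y = hdot H x (T y).

Definition is_inverse T S := [/\ bounded_operator S, cancel T S & cancel S T].

Definition invertible T := exists S, is_inverse T S.

Definition inverse T : H -> H := xget (fun=> 0) [set S | is_inverse T S].

Definition kernel T : set H := [set x | T x = 0].

Definition orth_proj V x : H :=
  xget 0 [set y | V y /\ forall v, V v -> hdot H (x - y) v = 0].

Definition lin_indep (n : nat) (u : 'I_n -> H) :=
  forall c : 'I_n -> R[i], \sum_(i < n) c i *: u i = 0 -> forall i, c i = 0.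

Definition dimension V : \bar R :=
  ereal_sup [set n%:R%:E | n in [set n | exists u : 'I_n -> H,
    (forall i, V (u i)) /\ lin_indep u]].

(* Finite-dimensional kernel and cokernel; for a bounded operator this forces
   the range to be closed. *)
Definition fredholm T :=
  [/\ bounded_operator T, (dimension (kernel T) < +oo)%E &
      exists (n : nat) (u : 'I_n -> H), forall y,
        exists x (c : 'I_n -> R[i]), y = T x + \sum_(i < n) c i *: u i].

Definition generalized_eigenspace T (l : R[i]) : set H :=
  [set x | exists k : nat, iter k (fun y => T y - l *: y) x = 0].

(* 0 when l is not an eigenvalue; for selfadjoint T it is dim ker (T - l). *)
Definition algebraic_multiplicity T (l : R[i]) : \bar R :=
  dimension (generalized_eigenspace T l).

Definition is_trace T (t : R[i]) :=
  exists (n : nat) (u v : 'I_n -> H),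
    (forall x, T x = \sum_(i < n) hdot H x (v i) *: u i) /\
    t = \sum_(i < n) hdot H (u i) (v i).

(* || A(w + h) - A(w) - h B || <= e |h| in operator norm for h near 0 *)
Definition is_op_derivative (A : R[i] -> H -> H) (w : R[i]) (B : H -> H) :=
  bounded_operator B /\
  forall e : R, 0 < e -> \forall h \near (0 : R[i]), forall x,
    `|A (w + h) x - A w x - h *: B x| <= e%:C * `|h| * `|x|.

Definition op_derivative (A : R[i] -> H -> H) (w : R[i]) : H -> H :=
  xget (fun=> 0) [set B | is_op_derivative A w B].

Definition op_holomorphic (D : set R[i]) (A : R[i] -> H -> H) :=
  forall z, D z -> bounded_operator (A z) /\ exists B, is_op_derivative A z B.

Definition complex_integral (a b : R) (f : R -> R[i]) : R[i] :=
  (\int[lebesgue_measure]_(t in `[a, b]) complex.Re (f t)) +i*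
  (\int[lebesgue_measure]_(t in `[a, b]) complex.Im (f t)).

(* w + rho e^(it) for 0 <= t <= 2 pi *)
Definition circle_integral (w : R[i]) (rho : R) (g : R[i] -> R[i]) : R[i] :=
  complex_integral 0 (2 * pi) (fun t =>
    let e := rho%:C * (cos t +i* sin t) in g (w + e) * ('i * e)).

(* For G norm-continuous on the circle, the norm-convergent integral of G is
   the operator determined by its matrix elements. *)
Definition is_op_circle_integral (w : R[i]) (rho : R) (G : R[i] -> H -> H) T :=
  forall x y,
    hdot H (T x) y = circle_integral w rho (fun z => hdot H (G z x) y).

End Operators.

Section Plane.
Variable R : realType.
Implicit Types (U Omega : set R[i]) (f : R[i] -> R).

Definition domain Omega := [/\ open Omega, connected Omega & Omega !=set0].

Definition boundary Omega : set R[i] := closure Omega `\` Omega°.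

Definition real_trace Omega : set R := [set x | Omega x%:C].

Definition line_x f (z : R[i]) : R -> R := fun t => f (z + t%:C).
Definition line_y f (z : R[i]) : R -> R := fun t => f (z + 'i * t%:C).
Definition partial_x f : R[i] -> R := fun z => derive1 (line_x f z) 0.
Definition partial_y f : R[i] -> R := fun z => derive1 (line_y f z) 0.

Fixpoint smooth_upto (n : nat) U f : Prop :=
  {in U, continuous f} /\
  if n is m.+1 then
    [/\ forall z, U z -> derivable (line_x f z) 0 1 /\
                         derivable (line_y f z) 0 1,
        smooth_upto m U (partial_x f) & smooth_upto m U (partial_y f)]
  else True.

Definition smooth U f := forall n, smooth_upto n U f.

(* phi is a local defining function: Omega = {phi < 0} near p, d phi(p) != 0.
   The tangent line of the boundary at p is ker d phi(p), so it is transverse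
   to the real axis iff the x-derivative of phi does not vanish at p. *)
Definition smooth_boundary_transverse Omega :=
  forall p, boundary Omega p -> exists (U : set R[i]) (phi : R[i] -> R),
    [/\ open_nbhs p U, smooth U phi,
        partial_x phi p != 0 \/ partial_y phi p != 0,
        forall z, U z -> (Omega z <-> phi z < 0) &
        (complex.Im p = 0 -> partial_x phi p != 0)].

Definition sector (theta a b : R) : set R[i] :=
  [set z | a <= complex.Re z <= b /\
           `|complex.Im z| <= theta * `|complex.Re z|].

(* |a - b| <= c, written so as to avoid +oo - +oo *)
Definition close_within (a b c : \bar R) := (a <= b + c /\ b <= a + c)%E.

End Plane.

Section CharacteristicValues.
Variables (R : realType) (H : hilbertSpace R).
Variables (D : set R[i]) (A : R[i] -> H -> H).

Definition Fop (z : R[i]) : H -> H := fun x => x - z^-1 *: A z x.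

Definition characteristic_value (w : R[i]) :=
  [/\ D w, w != 0 & ~ invertible (Fop w)].

(* m = (2 i pi)^-1 tr \int_(|z - w| = rho) F'(z) F(z)^-1 dz, rho small *)
Definition has_multiplicity (w : R[i]) (m : nat) :=
  exists2 rho0 : R, 0 < rho0 & forall rho : R, 0 < rho < rho0 ->
    exists (T : H -> H) (t : R[i]),
      [/\ is_op_circle_integral w rho
            (fun z => op_derivative Fop z \o inverse (Fop z)) T,
          is_trace T t & m%:R = (2 * 'i * pi%:C)^-1 * t].

Definition multiplicity (w : R[i]) : nat :=
  xget 0%N [set m | has_multiplicity w m].

Definition Ncount (Omega : set R[i]) : \bar R :=
  \esum_(w in characteristic_value `&` (Omega `\ 0)) (multiplicity w)%:R%:E.

Definition ncount (L : set R) : \bar R :=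
  \esum_(l in L) algebraic_multiplicity (A 0) l%:C.

Definition hyp_compact := forall z, D z -> compact_operator (A z).

Definition hyp_selfadjoint := selfadjoint (A 0).

Definition hyp_invertible :=
  invertible (fun x => x - op_derivative A 0 (orth_proj (kernel (A 0)) x)).

Definition concl_small_domains :=
  forall Omega : set R[i],
    domain Omega -> compact (closure Omega) -> ~ closure Omega 0 ->
    smooth_boundary_transverse Omega ->
    let J := real_trace Omega in
    let I (delta : R) := [set x + t | x in real_trace (boundary Omega)
                                    & t in `[- delta, delta]] in
    exists C delta1 : R, [/\ 0 < C, 0 < delta1 &
      forall delta : R, 0 < delta < delta1 ->
        exists2 sdelta : R, 0 < sdelta & forall s : R, 0 < s < sdelta ->
          close_within
            (Ncount [set s%:C * z | z in Omega])
            (ncount [set s * x | x in J])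
            ((C * `|ln delta| ^+ 2)%:E *
               ncount [set (s * x)%R | x in I delta])%E].

Definition concl_sectors :=
  forall theta : R, 0 < theta ->
    (forall r : R, 0 < r < 1 -> sector theta r 1 `<=` D) ->
    exists C delta1 : R, [/\ 0 < C, 0 < delta1 &
      forall delta : R, 0 < delta < delta1 ->
        exists rdelta Cdelta : R, [/\ 0 < rdelta, 0 < Cdelta &
          forall r : R, 0 < r < rdelta ->
            close_within
              (Ncount (sector theta r 1))
              (ncount `[r, 1])
              ((C * delta * `|ln delta| ^+ 2)%:E * ncount `[r, 1%R]
               + (C * `|ln delta| ^+ 2)%:E *
                   ncount `[(r * (1 - delta))%R, (r * (1 + delta))%R]
               + Cdelta%:E)%E]].

Definition fredholm_family :=
  [/\ domain D, D 0, op_holomorphic D A,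
      forall z, D z -> z != 0 -> fredholm (Fop z) &
      exists z0, [/\ D z0, z0 != 0 & invertible (Fop z0)]].

End CharacteristicValues.

(* Main.v *)
(* The three examples act on l^2(N) with D = C. In each of them the positive
   eigenvalues of A(0) are the numbers lam n = 64^-n, n >= 1, with finite
   multiplicities, whereas F(z) is invertible for Re z > 0, so that N vanishes on
   all the sets that matter; since the eigenvalues are sparse, (C1) and (C2) fail.
   Let L = diag(lam n) with lam 0 = 0, and let e_0 be the first basis vector, which
   spans the kernel of A(0).
   (i) A(z) = L + 2 z, so that F(z) = - (I + L / z).
   (ii) F(z)(x, y) = (x + <y, u> / z, x v + (I - L / z) y), where x is the entry
   on e_0 and A(0) = L - <., u> e_0 is not selfadjoint.
   (iii) F(z) is the operator of (ii) with its first row multiplied by z; now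
   A(0) = L, but I - A'(0) Pi_0 has range orthogonal to e_0.
   In (ii) and (iii), eliminating y leads to the function
   1 - sum_n u_n v_n / (z - lam n), and the choice u_n v_n = 2 (-1)^n lam n puts its
   zeros near the points - lam n, away from Re z > 0. *)

(* The signs alternate so that the Schur complement keeps its size at every scale. The term of index
   k contributes about 2 (-1)^k when |z| is far below lam k and almost nothing when |z| is far above
   it. The sum 1 + 2 sum_(1 <= k < m) (-1)^k equals - (-1)^m, so it never leaves {1, -1}. The
   remaining term, k = m, turns this into the factor (z + lam m) / (z - lam m), whose modulus is at
   least 1 on Re z > 0. The obstacle is that z = lam m itself lies in this half-plane, and there I -
   L / z is not invertible. Hence only the entries other than 0 and m are eliminated, and the
   remaining 2x2 determinant has no pole at lam m. The ratio 64 is large enough for the errors of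
   all other eigenvalues to add up to at most 3/5 < 1. It is also a square, so that u_n and v_n can
   both have size 8^-n and lie in l^2. The families are found from the desired F by A(z) = z (I -
   F(z)). Multiplying a row by z raises the degree to 2, so all three are treated as quadratic
   polynomials in z with operator coefficients. *)
From HB Require Import structures.
Require Import Defs.
From mathcomp Require Import all_boot all_order all_algebra.
From mathcomp Require Import complex sesquilinear zify ring lra.
From mathcomp Require Import all_classical all_reals all_analysis.

Set Implicit Arguments.
Unset Strict Implicit.
Unset Printing Implicit Defensive.

Import Order.TTheory GRing.Theory Num.Theory.
Import numFieldNormedType.Exports.

Local Open Scope classical_set_scope.
Local Open Scope ring_scope.
Local Open Scope complex_scope.

(** * The topology of the complex plane and complex series *)

Section ComplexPlane.
Variable R : realType.
Local Notation C := R[i].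
Implicit Types z w : C.

Lemma normC_ge_Im z : `|complex.Im z|%:C <= `|z|.
Proof.
case: z => a b; rewrite normc_def /= lecR -sqrtr_sqr ler_wsqrtr//.
by rewrite lerDr sqr_ge0.
Qed.

Lemma normCR (x : R) : `|x%:C| = `|x|%:C.
Proof. by rewrite normc_def /= expr0n /= addr0 sqrtr_sqr. Qed.

Lemma ge0C_real z : 0 <= z -> exists2 r : R, 0 <= r & z = r%:C.
Proof. by case: z => a b; rewrite lecE /= => /andP[/eqP -> a0]; exists a. Qed.

Lemma normC_real z : exists2 r : R, 0 <= r & `|z| = r%:C.
Proof. by apply: ge0C_real; exact: normr_ge0. Qed.

Lemma gt0C_real z : 0 < z -> exists2 r : R, 0 < r & z = r%:C.
Proof.
case: z => a b; rewrite ltcE /= => /andP[/eqP -> a0]; exists a => //.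
Qed.

Lemma ReD z w : complex.Re (z + w) = complex.Re z + complex.Re w.
Proof. by case: z w => [a b] [c d]. Qed.

Lemma ImD z w : complex.Im (z + w) = complex.Im z + complex.Im w.
Proof. by case: z w => [a b] [c d]. Qed.

Lemma ReB z w : complex.Re (z - w) = complex.Re z - complex.Re w.
Proof. by case: z w => [a b] [c d]. Qed.

Lemma ImB z w : complex.Im (z - w) = complex.Im z - complex.Im w.
Proof. by case: z w => [a b] [c d]. Qed.

Lemma continuous_Re : continuous (@complex.Re R : C -> R).
Proof.
move=> z; have F : Filter (nbhs z) by exact: nbhs_filter.
apply/cvgrPdist_lt => e e0; apply/nbhs_ballP.
exists e%:C => [|w zw]; first by rewrite /= ltcR.
by rewrite -ltcR -ReB (le_lt_trans (normc_ge_Re _)).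
Qed.

Lemma continuous_Im : continuous (@complex.Im R : C -> R).
Proof.
move=> z; have F : Filter (nbhs z) by exact: nbhs_filter.
apply/cvgrPdist_lt => e e0; apply/nbhs_ballP.
exists e%:C => [|w zw]; first by rewrite /= ltcR.
by rewrite -ltcR -ImB (le_lt_trans (normC_ge_Im _)).
Qed.

Lemma continuous_realC : continuous (fun x : R => x%:C : C).
Proof.
move=> z; apply/cvgrPdist_lt => e /gt0C_real[r r0 ->]; apply/nbhs_ballP.
exists r => //= w zw.
by rewrite -raddfB normCR ltcR.
Qed.

Lemma continuous_complex : continuous (fun p : R * R => p.1 +i* p.2 : C).
Proof.
have -> : (fun p : R * R => p.1 +i* p.2 : C) = (fun p => p.1%:C + 'i * p.2%:C).
  by apply/funext => -[a b]; rewrite [LHS]complexE complexiE.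
move=> p; apply: cvgD.
  by apply: continuous_comp; [exact: cvg_fst | exact: continuous_realC].
apply: cvgM; first exact: cvg_cst.
by apply: continuous_comp; [exact: cvg_snd | exact: continuous_realC].
Qed.

Lemma compact_square (a b c d : R) :
  compact [set z : C | a <= complex.Re z <= b /\ c <= complex.Im z <= d].
Proof.
have -> : [set z : C | a <= complex.Re z <= b /\ c <= complex.Im z <= d] =
    (fun p : R * R => p.1 +i* p.2) @` (`[a, b]%classic `*` `[c, d]%classic).
  apply/seteqP; split => [[x y] /= [ax cy]|_ [[x y] /= [ax cy]] <- /=].
    by exists (x, y); rewrite //= !in_itv.
  by move: ax cy; rewrite !in_itv.
apply: continuous_compact; last first.
  by apply: compact_setX; exact: segment_compact.
by apply: continuous_subspaceT; exact: continuous_complex.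
Qed.

Lemma abs_mul_le (a b : C) : `|a| * `|b| <= `|a| ^+ 2 + `|b| ^+ 2.
Proof.
have [ab|ba] := real_leP (normr_real a) (normr_real b).
  by rewrite (le_trans (ler_wpM2r _ ab))// -expr2 lerDr exprn_ge0.
by rewrite (le_trans (ler_wpM2l _ (ltW ba)))// -expr2 lerDl exprn_ge0.
Qed.

Lemma sqr_normD_le (a b : C) : `|a + b| ^+ 2 <= 2 * (`|a| ^+ 2 + `|b| ^+ 2).
Proof.
have h : `|a + b| ^+ 2 <= (`|a| + `|b|) ^+ 2.
  by rewrite lerXn2r ?nnegrE ?addr_ge0// ler_normD.
apply: (le_trans h); rewrite -subr_ge0.
have -> : 2 * (`|a| ^+ 2 + `|b| ^+ 2) - (`|a| + `|b|) ^+ 2 =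
  (`|a| - `|b|) ^+ 2 by ring.
by apply: real_exprn_even_ge0 => //; rewrite rpredB ?normr_real.
Qed.

Lemma dist_cvg_le (V : normedModType C) (f : nat -> V) (l c : V) (E : C) (N : nat) :
  f @ \oo --> l -> (forall n, (N <= n)%N -> `|c - f n| <= E) -> `|c - l| <= E.
Proof.
move=> fl fE; apply/ler_addgt0Pr => e e0.
have /cvgr_distC_le/(_ e e0)[M _ fM] := fl.
rewrite -(subrK (f (maxn N M)) c) -addrA (le_trans (ler_normD _ _))// lerD//.
  by apply: fE; exact: leq_maxl.
by apply: fM => /=; exact: leq_maxr.
Qed.

(** The order of C is only partial, so the closedness of the nonnegative cone comes from the
    continuity of the norm: f = |f| forces l = |l|. *)
Lemma cvg_ge0 (f : nat -> C) (l : C) :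
  f @ \oo --> l -> (forall n, 0 <= f n) -> 0 <= l.
Proof.
move=> fl f0; have nl := cvg_norm fl.
have e : (fun n => `|f n|) = f by apply/funext => n; rewrite ger0_norm.
rewrite e in nl; have -> : l = `|l| by apply: (cvg_unique _ fl (nl _)).
exact: normr_ge0.
Qed.

Lemma cvg_complex (T : Type) (F : set_system T) (FF : Filter F) (f : T -> C)
    (a b : R) :
  complex.Re (f x) @[x --> F] --> a -> complex.Im (f x) @[x --> F] --> b ->
  f x @[x --> F] --> (a +i* b : C).
Proof.
move=> fa fb.
have -> : f = (fun p : R * R => p.1 +i* p.2 : C) \o
    (fun x => (complex.Re (f x), complex.Im (f x))).
  by apply/funext => x /=; case: (f x).
have fab : (complex.Re (f x), complex.Im (f x)) @[x --> F] --> (a, b).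
  by apply: (cvg_pair (FG := nbhs_filter a) (FH := nbhs_filter b)) => //.
exact: (cvg_comp _ _ fab (@continuous_complex (a, b))).
Qed.

Definition csummable (f : nat -> C) :=
  exists M : C, forall n, \sum_(0 <= k < n) `|f k| <= M.

Definition csum (f : nat -> C) : C := limn (series f).

(** Monotone convergence is a real argument, so real and imaginary parts are summed separately, both
    dominated by |f k|. The bound M is real because it lies above the empty sum. *)
Lemma csummable_cvg f : csummable f -> series f @ \oo --> csum f.
Proof.
move=> [M fM]; suff : cvgn (series f) by [].
have [m Mm] : exists m : R, M = m%:C.
  have := fM 0%N; rewrite big_nil => M0; exists (complex.Re M).
  by case: M M0 {fM} => a b; rewrite lecE /= => /andP[/eqP -> _].
have real_cvg (p : C -> R) : (forall z, `|p z|%:C <= `|z|) ->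
    cvgn (series (p \o f)).
  move=> pn; apply: normed_cvg; apply: nondecreasing_is_cvgn.
    by apply: nondecreasing_series => n _ _ /=.
  exists m => _ [n _ <-]; rewrite -lecR -Mm; apply: le_trans (fM n).
  by rewrite /= rmorph_sum /=; apply: ler_sum => k _; exact: pn.
have /cvg_ex[/= a fa] := real_cvg _ (@normc_ge_Re R).
have /cvg_ex[/= b fb] := real_cvg _ normC_ge_Im.
apply/cvg_ex; exists (a +i* b); apply: cvg_complex.
  rewrite (_ : (fun n => _) = series (@complex.Re R \o f))//.
  by apply/funext => n; rewrite /series /= (big_morph _ ReD (erefl _)).
rewrite (_ : (fun n => _) = series (@complex.Im R \o f))//.
by apply/funext => n; rewrite /series /= (big_morph _ ImD (erefl _)).
Qed.

Lemma csum_eq (f : nat -> C) l : series f @ \oo --> l -> csum f = l.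
Proof. by move=> fl; apply: cvg_lim. Qed.

Lemma csumD f g : csummable f -> csummable g ->
  csum (fun n => f n + g n) = csum f + csum g.
Proof.
move=> /csummable_cvg fl /csummable_cvg gl; 
have fgl : (fun n => series f n + series g n) @ \oo --> csum f + csum g.
  exact: (@cvgD _ _ nat _ _ (series f) (series g) _ _ fl gl).
rewrite -(cvg_lim _ fgl)//; congr (limn _).
by apply/funext => n; rewrite /series /= big_split.
Qed.

Lemma csumZ f (a : C) : csummable f -> csum (fun n => a * f n) = a * csum f.
Proof.
move=> /csummable_cvg fl.
have afl : (fun n => a * series f n) @ \oo --> a * csum f.
  by apply: (@cvgM _ nat _ _ (cst a) (series f) _ _ _ fl); exact: cvg_cst.
rewrite -(cvg_lim _ afl)//; congr (limn _).
by apply/funext => n; rewrite /series /= mulr_sumr.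
Qed.

Lemma csum_conj f : csummable f -> csum (fun n => (f n)^*%R) = ((csum f)^*)%R.
Proof.
move=> /csummable_cvg fl; apply: csum_eq.
apply/cvgrPdist_lt => e e0; have /cvgr_dist_lt/(_ e e0)[N _ fN] := fl.
exists N => // n Nn; have := fN n Nn.
by rewrite /series /= -rmorph_sum -rmorphB norm_conjC.
Qed.

Lemma csum_le f n : csummable f -> (forall k, 0 <= f k) ->
  \sum_(0 <= k < n) f k <= csum f.
Proof.
move=> /csummable_cvg fl f0; rewrite -subr_ge0.
apply: (@cvg_ge0 (fun m => series f (m + n)%N - \sum_(0 <= k < n) f k)).
  apply: cvgB; last exact: cvg_cst.
  by have := fl; rewrite -(cvg_shiftn n).
move=> m; rewrite /series /= (big_cat_nat (leq0n n) (leq_addl m n)) /=.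
by rewrite addrAC subrr add0r; apply: sumr_ge0.
Qed.

Lemma csum_ub f M : csummable f -> (forall n, \sum_(0 <= k < n) f k <= M) ->
  csum f <= M.
Proof.
move=> /csummable_cvg fl fM; rewrite -subr_ge0.
apply: (@cvg_ge0 (fun n => M - series f n)).
  by apply: (@cvgB _ _ nat _ _ (cst M) (series f) _ _ _ fl); exact: cvg_cst.
by move=> n; rewrite subr_ge0; exact: fM.
Qed.

Lemma csum_single f n : (forall k, k != n -> f k = 0) -> csum f = f n.
Proof.
move=> f0; apply: csum_eq; apply/cvgrPdist_lt => e e0; exists n.+1 => // m /= nm.
rewrite /series /= (bigD1_seq n) ?iota_uniq ?mem_index_iota //=.
by rewrite big1 ?addr0 ?subrr ?normr0// => k kn; exact: f0.
Qed.

End ComplexPlane.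

(** * The Hilbert space of square-summable sequences *)

Section SquareSummable.
Variable R : realType.
Local Notation C := R[i].
Implicit Types x y : nat -> C.

Definition sqsum : {pred nat -> C} :=
  [pred x | `[< csummable (fun n => `|x n| ^+ 2) >]].

Lemma sqsumP x :
  reflect (exists M, forall n, \sum_(0 <= k < n) `|x k| ^+ 2 <= M) (x \in sqsum).
Proof.
have e n : \sum_(0 <= k < n) `| `|x k| ^+ 2 | = \sum_(0 <= k < n) `|x k| ^+ 2.
  by apply: eq_bigr => k _; rewrite normrX normr_id.
apply: (iffP idP) => [/asboolP|] [M xM]; [|apply/asboolP]; exists M => n.
  by rewrite -e.
by rewrite e.
Qed.

Lemma sqsum_submod_closed : submod_closed sqsum.
Proof.
split; first by apply/sqsumP; exists 0 => n; rewrite big1// => k _;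
  rewrite normr0 expr0n.
move=> a x y /sqsumP[M xM] /sqsumP[N yN]; apply/sqsumP.
exists (2 * (`|a| ^+ 2 * M + N)) => n.
have : \sum_(0 <= k < n) `|a * x k + y k| ^+ 2 <=
    \sum_(0 <= k < n) 2 * (`|a| ^+ 2 * `|x k| ^+ 2 + `|y k| ^+ 2).
  by apply: ler_sum => k _; rewrite -exprMn -normrM sqr_normD_le.
move/le_trans; apply; rewrite -mulr_sumr ler_wpM2l ?ler0n//.
by rewrite big_split /= -mulr_sumr lerD// ler_wpM2l ?exprn_ge0.
Qed.

HB.instance Definition _ :=
  GRing.isSubmodClosed.Build C (nat -> C) sqsum sqsum_submod_closed.

Record ell2 := Ell2 { entry : nat -> C; entryP : entry \in sqsum }.

HB.instance Definition _ := [isSub for entry].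
HB.instance Definition _ := [Choice of ell2 by <:].
HB.instance Definition _ := [SubChoice_isSubLmodule of ell2 by <:].

Arguments entry : simpl never.

Implicit Types u v w : ell2.

Lemma ell2P u v : entry u =1 entry v -> u = v.
Proof. by move=> uv; apply: val_inj; apply/funext. Qed.

Lemma entryD u v n : entry (u + v) n = entry u n + entry v n. Proof. by []. Qed.
Lemma entryN u n : entry (- u) n = - entry u n. Proof. by []. Qed.
Lemma entryB u v n : entry (u - v) n = entry u n - entry v n. Proof. by []. Qed.
Lemma entryZ a u n : entry (a *: u) n = a * entry u n. Proof. by []. Qed.
Lemma entry0 n : entry 0 n = 0. Proof. by []. Qed.
Definition entryE := (entryD, entryN, entryZ, entry0).

Lemma entry_sum (I : Type) (r : seq I) (P : pred I) (F : I -> ell2) n :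
  entry (\sum_(i <- r | P i) F i) n = \sum_(i <- r | P i) entry (F i) n.
Proof. by elim/big_rec2: _ => // i _ u _ <-. Qed.

Lemma csummable_sqr u : csummable (fun n => `|entry u n| ^+ 2).
Proof. exact/asboolP/entryP. Qed.

Lemma csummable_dot u v : csummable (fun n => entry u n * ((entry v n)^*)%R).
Proof.
have /sqsumP[M uM] := entryP u; have /sqsumP[N vN] := entryP v.
exists (M + N) => n; apply: le_trans (lerD (uM n) (vN n)).
rewrite -big_split /=; apply: ler_sum => k _.
by rewrite normrM norm_conjC abs_mul_le.
Qed.

Definition dot u v : C := csum (fun n => entry u n * ((entry v n)^*)%R).

Lemma dot_linearl v : GRing.linear_for *%R (dot ^~ v).
Proof.
move=> a x y; rewrite /dot -csumZ; last exact: csummable_dot.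
have e : (fun n => a * (entry x n * ((entry v n)^*)%R)) =
  (fun n => entry (a *: x) n * ((entry v n)^*)%R).
  by apply/funext => n; rewrite entryZ mulrA.
rewrite e -csumD; [|exact: csummable_dot..].
by congr csum; apply/funext => n; rewrite !entryE mulrDl.
Qed.

Lemma dotC u v : dot u v = ((dot v u)^*)%R.
Proof.
rewrite /dot -csum_conj; last exact: csummable_dot.
by congr csum; apply/funext => n; rewrite rmorphM /= conjCK mulrC.
Qed.

Lemma dot_linearr u : GRing.linear_for (Num.conj \; *%R) (dot u).
Proof.
move=> a x y; rewrite dotC dot_linearl rmorphD rmorphM /=.
by rewrite -!dotC.
Qed.

HB.instance Definition _ := @bilinear_isBilinear.Build C ell2 ell2 C
  *%R (Num.conj \; *%R) dot (dot_linearl, dot_linearr).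

Lemma dot_hermitian u v : dot u v = (-1) ^+ false * ((dot v u)^*)%R.
Proof. by rewrite expr0 mul1r -dotC. Qed.

HB.instance Definition _ := @isHermitianSesquilinear.Build C ell2 false
  Num.conj dot dot_hermitian.

Lemma dotxx_ge n u : \sum_(0 <= k < n) `|entry u k| ^+ 2 <= dot u u.
Proof.
rewrite /dot (_ : (fun n => _) = (fun n => `|entry u n| ^+ 2)).
  by apply: csum_le => [|k]; [exact: csummable_sqr|exact: exprn_ge0].
by apply/funext => k; rewrite normCK.
Qed.

Lemma dotxx_le u M : (forall n, \sum_(0 <= k < n) `|entry u k| ^+ 2 <= M) ->
  dot u u <= M.
Proof.
rewrite /dot (_ : (fun n => _) = (fun n => `|entry u n| ^+ 2)).
  by move=> uM; apply: csum_ub => //; exact: csummable_sqr.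
by apply/funext => k; rewrite normCK.
Qed.

Lemma entry_le_dot u n : `|entry u n| ^+ 2 <= dot u u.
Proof.
by apply: le_trans (dotxx_ge n.+1 u); rewrite big_nat_recr //= lerDr sumr_ge0.
Qed.

Lemma dot_gt0 u : u != 0 -> 0 < dot u u.
Proof.
move=> u0; rewrite lt_def; apply/andP; split; last first.
  by have := dotxx_ge 0 u; rewrite big_nil.
apply: contra u0 => /eqP d0; apply/eqP/ell2P => n.
apply/eqP; rewrite entry0 -normr_eq0 -sqrf_eq0 eq_le exprn_ge0// andbT -d0.
exact: entry_le_dot.
Qed.

HB.instance Definition _ := @isDotProduct.Build C ell2 dot dot_gt0.

End SquareSummable.

Arguments entry {R} _ _%_N : simpl never.

(** * The norm of an inner product *)

Section DotNorm.
Variables (C : numClosedFieldType) (U : lmodType C) (form : {dot U for Num.conj}).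
Local Notation "''[' u , v ]" := (form u%R v%R) : ring_scope.
Local Notation "''[' u ]" := '[u, u]%R : ring_scope.

Lemma dot_CauchySchwarz u v : `|'[u, v]| ^+ 2 <= '[u] * '[v].
Proof.
have [->|v0] := eqVneq v 0; first by rewrite linear0r normr0 expr0n mulr_ge0.
have vv : 0 < '[v] by rewrite dnorm_gt0.
have vr : ('[v]^* = '[v])%R by apply: CrealP; rewrite gtr0_real.
set d := '[u, v]; have := dnorm_ge0 form (u - (d / '[v]) *: v).
rewrite dnormB dnormZ linearZr_LR /= -/d normCK !rmorphM !fmorphV /= conjCK !vr.
have -> : '[u] + d / '[v] * (d^*%R / '[v]) * '[v] -
    (d^*%R / '[v] * d + d / '[v] * d^*%R) = '[u] - `|d| ^+ 2 / '[v].
  by rewrite normCK; field; rewrite gt_eqF.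
by rewrite subr_ge0 ler_pdivrMr.
Qed.

Lemma sqrt_dnormD u v : sqrtC '[u + v] <= sqrtC '[u] + sqrtC '[v].
Proof.
have uv0 : 0 <= sqrtC '[u] + sqrtC '[v] by rewrite addr_ge0 ?sqrtC_ge0 ?dnorm_ge0.
rewrite -[leRHS]sqrCK// ler_sqrtC ?qualifE/= ?exprn_ge0//.
rewrite sqrrD !sqrtCK dnormD [leRHS]addrAC lerD2l -mulr_natl.
set d := '[u, v].
have dr : d + d^*%R \is Num.real by rewrite CrealE rmorphD /= conjCK addrC.
apply: (le_trans (real_ler_norm dr)); apply: (le_trans (ler_normD _ _)).
rewrite norm_conjC -mulr2n -[leLHS]mulr_natl ler_pM2l ?ltr0n//.
rewrite -sqrtCM ?qualifE//= -[leLHS]sqrCK// ler_sqrtC ?qualifE/= ?exprn_ge0//.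
  exact: dot_CauchySchwarz.
by rewrite mulr_ge0.
Qed.

Lemma sqrt_dnormZ a u : sqrtC '[a *: u] = `|a| * sqrtC '[u].
Proof. by rewrite dnormZ sqrtCM ?qualifE/= ?exprn_ge0// sqrCK. Qed.

Lemma sqrt_dnorm0 u : sqrtC '[u] = 0 -> u = 0.
Proof. by move/eqP; rewrite sqrt_dnorm_eq0 => /eqP. Qed.

End DotNorm.

(** * Norm and completeness of l^2 *)

Section Ell2Hilbert.
Variable R : realType.
Local Notation C := R[i].

HB.instance Definition _ := @Lmodule_isNormed.Build C (ell2 R)
  (fun u => sqrtC (dot u u)) (@sqrt_dnormD _ _ (@dot R))
  (@sqrt_dnormZ _ _ (@dot R)) (@sqrt_dnorm0 _ _ (@dot R)).

Implicit Types u v w : ell2 R.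

Lemma ell2_normE u : `|u| ^+ 2 = dot u u.
Proof. exact: sqrtCK. Qed.

Lemma ell2_norm_le u M : 0 <= M ->
  (forall n, \sum_(0 <= k < n) `|entry u k| ^+ 2 <= M ^+ 2) -> `|u| <= M.
Proof.
by move=> M0 uM; rewrite -ler_sqr ?qualifE//= ell2_normE; exact: dotxx_le.
Qed.

Lemma entry_sum_le u n : \sum_(0 <= k < n) `|entry u k| ^+ 2 <= `|u| ^+ 2.
Proof. by rewrite ell2_normE dotxx_ge. Qed.

Lemma entry_le u n : `|entry u n| <= `|u|.
Proof. by rewrite -ler_sqr ?qualifE//= ell2_normE; exact: entry_le_dot. Qed.

(** Each coordinate is 1-Lipschitz, and so are its real and imaginary parts, to which the
    completeness of R applies. *)
Lemma entry_cauchy (F : set_system (ell2 R)) n : ProperFilter F -> cauchy F ->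
  exists a : C, entry u n @[u --> F] --> a.
Proof.
move=> FF /cauchyP Fc.
have H (p : C -> R) : (forall a b, `|p a - p b|%:C <= `|a - b|) ->
    exists a : R, p (entry u n) @[u --> F] --> a.
  move=> pl; apply/cvg_ex; apply: cauchy_cvg; apply/cauchyP => e e0.
  have [|u Fu] := Fc e%:C; first by rewrite ltcR.
  exists (p (entry u n)); apply: (@filterS _ F _ _ _ _ Fu) => v uv /=.
  rewrite -ball_normE /= -ltcR; apply: le_lt_trans (pl _ _) _.
  move: uv; rewrite -ball_normE /=; apply: le_lt_trans.
  by rewrite -entryB entry_le.
have [|a ra] := H (@complex.Re R).
  by move=> a b; rewrite -ReB normc_ge_Re.
have [|b ib] := H (@complex.Im R).
  by move=> a' b; rewrite -ImB normC_ge_Im.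
by exists (a +i* b); exact: cvg_complex.
Qed.

Lemma ell2_complete (F : set_system (ell2 R)) :
  ProperFilter F -> cauchy F -> cvg F.
Proof.
move=> FF Fc.
have /choice[x xF] : forall n, exists a : C, entry u n @[u --> F] --> a.
  by move=> n; exact: entry_cauchy.
(* The candidate limit x is only coordinatewise. For fixed n finitely many coordinates occur, so v
   may tend to x while u stays fixed; the resulting bound does not depend on n and hence is a bound
   in norm. *)
have main e : 0 < e -> \forall u \near F,
    forall n, \sum_(0 <= k < n) `|entry u k - x k| ^+ 2 <= e ^+ 2.
  move=> e0; have /cauchyP/(_ (e / 2))[|u0 Fu0] := Fc; first by rewrite divr_gt0.
  apply: filterS (Fu0) => u uu0 n; apply/ler_addgt0Pr => d d0.
  have cv : \sum_(0 <= k < n) `|entry u k - entry v k| ^+ 2 @[v --> F] -->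
      \sum_(0 <= k < n) `|entry u k - x k| ^+ 2.
    apply: (cvg_big (op := +%R) (x0 := 0 : C)) => // [|k _].
      exact: add_continuous.
    have c : `|entry u k - entry v k| @[v --> F] --> `|entry u k - x k|.
      by apply: cvg_norm; apply: cvgB; [exact: cvg_cst|exact: xF].
    by rewrite expr2; under eq_cvg do rewrite expr2; apply: cvgM.
  have /cvgr_dist_le/(_ d d0) cvd := cv.
  have [v [vd u0v]] := filter_ex (filterI cvd Fu0).
  set S := \sum_(0 <= k < n) `|entry u k - x k| ^+ 2.
  set h := \sum_(0 <= k < n) `|entry u k - entry v k| ^+ 2 in vd *.
  have -> : S = `|S| by rewrite ger0_norm// sumr_ge0// => k _; rewrite exprn_ge0.
  rewrite -(subrK h S) addrC; apply: (le_trans (ler_normD _ _)); apply: lerD => //.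
  rewrite ger0_norm; last by rewrite sumr_ge0// => k _; rewrite exprn_ge0.
  apply: le_trans (entry_sum_le (u - v) n) _.
  rewrite lerXn2r ?qualifE//= ?(ltW e0)//.
  move: uu0 u0v; rewrite -!ball_normE /= => uu0 u0v.
  rewrite -(subrK u0 u) -addrA (le_trans (ler_normD _ _))// (splitr e).
  by rewrite lerD// ltW// distrC.
have xs : x \in @sqsum R.
  have [u ux] := filter_ex (main 1 ltr01).
  have dx : (fun k => entry u k - x k) \in @sqsum R.
    by apply/sqsumP; exists (1 ^+ 2).
  have -> : x = entry u - (fun k => entry u k - x k).
    by apply/funext => k; rewrite /GRing.add /= /GRing.opp /= subKr.
  by rewrite rpredB// entryP.
apply/cvg_ex; exists (Ell2 xs); apply/cvgrPdist_le => e e0.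
apply: filterS (main e e0) => u ux; rewrite distrC.
by apply: ell2_norm_le (ltW e0) _.
Qed.

HB.instance Definition _ := Uniform_isComplete.Build (ell2 R) ell2_complete.

Definition ell2_hilbert : hilbertSpace R :=
  @HilbertSpace R (ell2 R : completeNormedModType C) (@dot R) ell2_normE.

End Ell2Hilbert.

(** * Separability and compact subsets of l^2 *)

Section Ell2Topology.
Variable R : realType.
Local Notation C := R[i].
Implicit Types (x y w : ell2 R) (f : nat -> C).

Lemma compact_discC (w : C) (r : R) : compact [set z : C | `|z - w| <= r%:C].
Proof.
apply: (@subclosed_compact _ _ [set z |
    complex.Re w - r <= complex.Re z <= complex.Re w + r
    /\ complex.Im w - r <= complex.Im z <= complex.Im w + r]); last 2 first.
- exact: compact_square.
- move=> z /= zr; rewrite -!ler_distl -ReB -ImB -!lecR.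
  by split; apply: le_trans zr; [exact: normc_ge_Re|exact: normC_ge_Im].
rewrite (_ : mkset _ = (fun z => complex.Re `|z - w|) @^-1` [set x | x <= r]).
  apply: preimage_closed; [|exact: closed_le] => z _.
  have F : Filter (nbhs z) by exact: nbhs_filter.
  have c : `|y - w| @[y --> z] --> `|z - w|.
    by apply: cvg_norm; apply: cvgB; [exact: cvg_id|exact: cvg_cst].
  exact: (cvg_comp _ _ c (@continuous_Re R _)).
have E z : (`|z - w| <= r%:C) = (complex.Re `|z - w| <= r).
  by have [s _ ->] := normC_real (z - w); rewrite lecR.
by apply/funext => z; apply/propext; rewrite /mkset /preimage/mkset E.
Qed.

(** The upper index [maxn N n] spares a distinction between n <= N and N <= n each time a head and a
    tail are estimated separately. *)
Lemma sum_le_split (g : nat -> C) n N : (forall k, 0 <= g k) ->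
  \sum_(0 <= k < n) g k <=
  \sum_(0 <= k < N) g k + \sum_(N <= k < maxn N n) g k.
Proof.
move=> g0; rewrite -big_cat_nat ?leq_maxl//=.
by rewrite [leRHS](big_cat_nat (leq0n n)) ?leq_maxr//= lerDl sumr_ge0.
Qed.

Lemma sqsum_finite f N : (forall n, (N <= n)%N -> f n = 0) -> f \in @sqsum R.
Proof.
move=> f0; apply/sqsumP; exists (\sum_(0 <= k < N) `|f k| ^+ 2) => n.
apply: (le_trans (@sum_le_split _ n N _)) => [k|]; first exact: exprn_ge0.
rewrite [X in _ + X]big_nat [X in _ + X]big1 ?addr0// => k /andP[Nk _].
by rewrite f0// normr0 expr0n.
Qed.

(** The value is 0 when f is not square-summable, so every computation of entries has to establish
    summability first. *)
Definition of_seq f : ell2 R := insubd 0 f.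

Lemma entry_of_seq f : f \in @sqsum R -> entry (of_seq f) = f.
Proof. exact: insubdK. Qed.

Definition trunc N x := of_seq (fun k => if (k < N)%N then entry x k else 0).

Lemma entry_trunc N x k : entry (trunc N x) k = if (k < N)%N then entry x k else 0.
Proof.
by rewrite entry_of_seq//; apply: (@sqsum_finite _ N) => n; rewrite ltnNge => ->.
Qed.

Lemma trunc_cvg x (e : R) : 0 < e -> exists N, `|x - trunc N x| <= e%:C.
Proof.
move=> e0; have xc := csummable_cvg (csummable_sqr x).
have e2 : 0 < (e ^+ 2)%:C by rewrite ltcR exprn_gt0.
have /cvgr_dist_le/(_ _ e2)[N _ xN] := xc.
exists N; apply: ell2_norm_le; first by rewrite ler0c ltW.
move=> n; apply: (le_trans (@sum_le_split _ n N _)) => [k|]; first exact: exprn_ge0.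
rewrite [X in X + _]big_nat big1 ?add0r; last first.
  by move=> k /andP[_ kN]; rewrite entryB entry_trunc kN subrr normr0 expr0n.
rewrite big_nat (eq_bigr (fun k => `|entry x k| ^+ 2)); last first.
  by move=> k /andP[Nk _]; rewrite entryB entry_trunc ltnNge Nk subr0.
rewrite -big_nat -rmorphXn /=; apply: le_trans (xN N (leqnn N)).
rewrite /series /= ger0_norm; last first.
  rewrite subr_ge0; apply: csum_le => [|k]; [exact: csummable_sqr|exact: exprn_ge0].
rewrite lerBrDl -big_cat_nat ?leq_maxl//=.
by apply: csum_le => [|k]; [exact: csummable_sqr|exact: exprn_ge0].
Qed.

Lemma ell2_separable : separable (ell2_hilbert R).
Proof.
pose q (p : rat * rat) : C := ratr p.1 +i* ratr p.2.
pose h (s : seq (rat * rat)) := of_seq (fun k => q (nth (0, 0) s k)).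
have hE s k : entry (h s) k = q (nth (0, 0) s k).
  rewrite entry_of_seq//; apply: (@sqsum_finite _ (size s)) => n sn.
  by rewrite nth_default// /q /= rmorph0.
exists (range h).
  exact: sub_countable (card_image_le _ _) _.
move=> O [x Ox] oO; have : nbhs x O by exact: open_nbhs_nbhs.
move=> /nbhs_ballP[e /gt0C_real[r r0 ->] xO].
have r4 : 0 < r / 4 by rewrite divr_gt0.
have [N xN] := trunc_cvg x r4.
(* The truncation costs r/4. Each of the N entries is approximated within 2 d, which costs at most
   r/2 because N (2 d)^2 <= (2 d (N + 1))^2; the total stays below r. *)
pose d : R := r / 4 / N.+1%:R.
have d0 : 0 < d by rewrite divr_gt0.
have rat_near (a : R) : exists p : rat, `|a - ratr p| <= d.
  have /rat_in_itvoo[p] : a - d < a + d by rewrite ltrD2l gtrN.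
  rewrite in_itv /= => /andP[/ltW ap /ltW pa]; exists p.
  by rewrite distrC ler_distl ap.
have /choice[p pP] : forall k, exists p : rat * rat, `|entry x k - q p| <= (2 * d)%:C.
  move=> k; have [a xa] := rat_near (complex.Re (entry x k)).
  have [b xb] := rat_near (complex.Im (entry x k)); exists (a, b).
  case: (entry x k) xa xb => xa xb /= ha hb.
  rewrite normc_def /= lecR -[leRHS]ger0_norm ?mulr_ge0 ?(ltW d0)//.
  rewrite -[leRHS]sqrtr_sqr ler_wsqrtr// -(real_normK (num_real (xa - _))).
  rewrite -(real_normK (num_real (xb - _))).
  have h1 : `|xa - ratr a| ^+ 2 <= d ^+ 2 by rewrite lerXn2r ?qualifE//= ltW.
  have h2 : `|xb - ratr b| ^+ 2 <= d ^+ 2 by rewrite lerXn2r ?qualifE//= ltW.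
  rewrite exprMn; have : 0 <= d ^+ 2 by rewrite exprn_ge0// ltW.
    lra.
  exact: ltW.
exists (h (mkseq p N)); split; last by exists (mkseq p N).
apply: xO; rewrite -ball_normE /=.
rewrite -(subrK (trunc N x) x) -addrA; apply: le_lt_trans (ler_normD _ _) _.
have -> : r%:C = (r / 4)%:C + (r / 4 * 3)%:C.
  by rewrite -rmorphD /=; congr (_%:C); field.
rewrite ler_ltD//; apply: (@le_lt_trans _ _ (r / 4 * 2)%:C); last first.
  by rewrite ltcR ltr_pM2l// ltr_nat.
apply: ell2_norm_le; first by rewrite ler0c mulr_ge0// ltW.
move=> n; apply: (le_trans (@sum_le_split _ n N _)) => [k|]; first exact: exprn_ge0.
rewrite [X in _ + X]big_nat [X in _ + X]big1 ?addr0; last first.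
  move=> k /andP[Nk _]; rewrite entryB entry_trunc ltnNge Nk hE nth_default ?size_mkseq//.
  by rewrite /q /= rmorph0 sub0r normrN normr0 expr0n.
apply: (@le_trans _ _ (\sum_(0 <= k < N) ((2 * d) ^+ 2)%:C)).
  rewrite !big_nat; apply: ler_sum => k /andP[_ kN].
  rewrite entryB entry_trunc kN hE nth_mkseq// rmorphXn lerXn2r ?qualifE//=.
  by rewrite ler0c mulr_ge0// ltW.
rewrite sumr_const_nat subn0 -rmorphMn -rmorphXn lecR -mulr_natl.
have -> : r / 4 * 2 = 2 * d * N.+1%:R by rewrite [LHS]mulrC /d -[RHS]mulrA divfK ?pnatr_eq0.
rewrite [leRHS]exprMn mulrC ler_wpM2l ?exprn_ge0 ?mulr_ge0 ?(ltW d0) ?(ltW r0)//.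
by rewrite -natrX ler_nat; lia.
Qed.

Definition cube w : set (ell2 R) := [set x | forall n, `|entry x n| <= `|entry w n| ].

(** The Hilbert cube. Tychonoff gives a cluster point for the product topology, and the common
    majorant w makes all tails uniformly small, which upgrades it to a cluster point in norm. *)
Lemma compact_cube w : compact (cube w).
Proof.
have /choice[c cE] : forall n, exists c : R, `|entry w n| = c%:C.
  by move=> n; have [s _ ->] := normC_real (entry w n); exists s.
have := @tychonoff nat (fun=> C : topologicalType)
  (fun n => [set z : C | `|z - 0| <= (c n)%:C])
  (fun n => @compact_discC 0 (c n)).
move=> T F FF Fw.
have [|f [fw fF]] := T (entry @ F) _.
  by apply: (@filterS _ F _ _ _ _ Fw) => x xw n; rewrite /mkset subr0 -cE.
have fle n : `|f n| <= `|entry w n| by have := fw n; rewrite /mkset subr0 cE.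
have fs : f \in @sqsum R.
  have /sqsumP[M wM] := entryP w; apply/sqsumP; exists M => n.
  by apply: le_trans (wM n); apply: ler_sum => k _; rewrite lerXn2r ?qualifE/=.
exists (Ell2 fs); split => // A B FA /nbhs_ballP[e /gt0C_real[r r0 ->] xB].
have r4 : 0 < r / 4 by rewrite divr_gt0.
have [N wN] := trunc_cvg w r4.
pose d : R := r / 4 / N.+1%:R.
have d0 : 0 < d by rewrite divr_gt0.
have FAw : (entry @ F) (entry @` (A `&` cube w)).
  by apply: (@filterS _ F _ _ _ _ (filterI FA Fw)) => x xA; exists x.
have nk (k : 'I_N) : nbhs f (fun g : nat -> C => `|f k - g k| < d%:C).
  have pk := @proj_continuous nat (fun=> C : topologicalType) k f.
  apply: (pk [set z : C | `|f k - z| < d%:C]).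
  by exists d%:C => //; rewrite /= ltcR.
have nf := filter_forall _ nk.
have [g [[x [Ax xw] <-] /= fx]] := fF _ _ FAw (nf (nbhs_filter f)).
exists x; split => //; apply: xB; rewrite -ball_normE /=.
apply: (@le_lt_trans _ _ (r / 4 * 3)%:C); last by rewrite ltcR; lra.
apply: ell2_norm_le; first by rewrite ler0c mulr_ge0// ltW.
move=> n; apply: (le_trans (@sum_le_split _ n N _)) => [k|]; first exact: exprn_ge0.
(* In the tail both points are bounded by |w_k|, whence the factor 4. The head is at most (r/4)^2
   and the tail at most 4 (r/4)^2, together less than (3 r/4)^2. *)
apply: (@le_trans _ _ (\sum_(0 <= k < N) (d ^+ 2)%:C +
    \sum_(N <= k < maxn N n) 4 * `|entry w k| ^+ 2)).
  apply: lerD; rewrite ?big_nat; apply: ler_sum => k.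
    move=> /andP[_ kN]; rewrite rmorphXn lerXn2r ?qualifE//= ?ler0c ?(ltW d0)//.
    exact/ltW/(fx (Ordinal kN)).
  move=> _; apply: (@le_trans _ _ ((2 * `|entry w k|) ^+ 2)); last first.
    by rewrite exprMn -natrX.
  rewrite lerXn2r ?qualifE/= ?mulr_ge0//.
  by rewrite entryB (le_trans (ler_normB _ _))// mulr_natl mulr2n lerD.
rewrite -mulr_sumr sumr_const_nat subn0 -rmorphMn -rmorphXn /=.
have tw : \sum_(N <= k < maxn N n) `|entry w k| ^+ 2 <= ((r / 4) ^+ 2)%:C.
  rewrite rmorphXn; apply: (@le_trans _ _ (`|w - trunc N w| ^+ 2)); last first.
    by rewrite lerXn2r ?qualifE//= ler0c ltW.
  apply: le_trans (entry_sum_le _ (maxn N n)).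
  rewrite [leRHS](big_cat_nat (leq0n N)) ?leq_maxl//.
  apply: ler_wpDl; first by apply: sumr_ge0 => k _; exact: exprn_ge0.
  rewrite !big_nat.
  by apply: ler_sum => k /andP[Nk _]; rewrite entryB entry_trunc ltnNge Nk subr0.
apply: (@le_trans _ _ ((d ^+ 2 *+ N)%:C + 4 * ((r / 4) ^+ 2)%:C)).
  by rewrite lerD2l ler_wpM2l.
have -> : (4 : C) = (4 : R)%:C by rewrite rmorph_nat.
rewrite -rmorphM -rmorphD lecR.
have : d ^+ 2 *+ N <= (r / 4) ^+ 2.
  have -> : r / 4 = d * N.+1%:R by rewrite /d divfK ?pnatr_eq0.
  rewrite [leRHS]exprMn -mulr_natr ler_wpM2l ?exprn_ge0 ?(ltW d0) ?(ltW r0)//.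
  by rewrite -natrX ler_nat; lia.
move=> h; rewrite [leRHS]exprMn; have : 0 <= (r / 4) ^+ 2 by rewrite exprn_ge0// ltW.
lra.
Qed.

Lemma compact_of_cube (T : ell2_hilbert R -> ell2_hilbert R) w :
  (forall x, `|x| <= 1 -> cube w (T x)) -> @compact_operator R (ell2_hilbert R) T.
Proof.
move=> Tw; exists (cube w); first by move=> _ [x /= x1 <-]; exact: Tw.
split; first exact: compact_cube.
by apply: compact_closed; [exact: norm_hausdorff|exact: compact_cube].
Qed.

End Ell2Topology.

(** * Bounded, Fredholm and holomorphic operators *)

Section Ell2Operators.
Variable R : realType.
Local Notation C := R[i].
Local Notation H := (ell2_hilbert R).
Implicit Types (x y w : H) (T S : H -> H) (V : set H).

Definition ebasis (n : nat) : ell2 R := of_seq (fun k => (k == n)%:R).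

Arguments ebasis n%_N.

Lemma entry_ebasis n k : entry (ebasis n) k = (k == n)%:R.
Proof.
rewrite entry_of_seq//; apply: (@sqsum_finite _ _ n.+1) => m nm.
by rewrite gtn_eqF.
Qed.

Lemma dot_ebasis x n : dot x (ebasis n) = entry x n.
Proof.
rewrite /dot (csum_single (n := n)) ?entry_ebasis ?eqxx ?conjC1 ?mulr1// => k kn.
by rewrite entry_ebasis (negPf kn) conjC0 mulr0.
Qed.

(** Taking the first N entries is injective on V. For n > N vectors these entries form an n x N
    matrix, and a nonzero row of its left kernel is a linear relation. *)
Lemma dimension_le (N : nat) V :
  (forall n (c : 'I_n -> C) (u : 'I_n -> H), (forall i, V (u i)) ->
     V (\sum_(i < n) c i *: u i)) ->
  (forall x, V x -> (forall k, (k < N)%N -> entry x k = 0) -> x = 0) ->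
  (dimension V <= N%:R%:E)%E.
Proof.
move=> Vlin Vinj; apply: ge_ereal_sup => _ [n [u [Vu u_free]] <-].
rewrite lee_fin ler_nat leqNgt; apply/negP => Nn.
pose M : 'M[C]_(n, N) := \matrix_(i, j) entry (u i) j.
have : kermx M != 0.
  rewrite kermx_eq0; apply/negP => /eqP rM.
  by have := rank_leq_col M; rewrite rM leqNgt Nn.
move=> /rowV0Pn[c /sub_kermxP cM /negP[]]; apply/eqP/rowP => i.
rewrite mxE; apply: (u_free (fun i => c 0 i)).
apply: Vinj => [|k kN]; first exact: Vlin.
rewrite entry_sum; have /rowP/(_ (Ordinal kN)) := cM.
rewrite !mxE => cMk; rewrite -[RHS]cMk; apply: eq_bigr => j _.
by rewrite entryZ mxE.
Qed.

Lemma dimension_ge1 V x : V x -> x != 0 -> (1 <= dimension V)%E.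
Proof.
move=> Vx x0; apply: ereal_sup_ubound; exists 1%N => //=; exists (fun=> x).
split=> // c; rewrite big_ord_recl big_ord0 addr0 => /eqP.
rewrite scaler_eq0 (negPf x0) orbF => /eqP c0 i.
by rewrite (ord1 i).
Qed.

Lemma dimension0 V : (forall x, V x -> x = 0) -> dimension V = 0%E.
Proof.
move=> V0; apply/eqP; rewrite eq_le; apply/andP; split.
  apply: ge_ereal_sup => _ [n [u [Vu u_free]] <-]; rewrite lee_fin.
  case: n u Vu u_free => // n u Vu /(_ (fun=> 1)) u1.
  have u0 : \sum_(i < n.+1) 1 *: u i = 0.
    by apply: big1 => i _; rewrite (V0 _ (Vu i)) scaler0.
  by have /eqP := u1 u0 ord0; rewrite oner_eq0.
apply: ereal_sup_ubound; exists 0%N => //=; exists (fun=> 0).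
by split=> [[]|c _ []].
Qed.

Lemma bopP T : bounded_operator T ->
  linear T /\ exists2 M : R, 0 <= M & forall x, `|T x| <= M%:C * `|x|.
Proof.
move=> [linT [M TM]]; split=> //; exists `|M| => // x.
by apply: le_trans (TM x) _; rewrite ler_wpM2r// lecR ler_norm.
Qed.

Lemma linearB_op T x y : linear T -> T (x - y) = T x - T y.
Proof. by move=> lT; rewrite -scaleN1r addrC lT scaleN1r addrC. Qed.

Lemma linear0_op T : linear T -> T 0 = 0.
Proof. by move=> lT; have := linearB_op 0 0 lT; rewrite !subrr. Qed.

Lemma bop_id : bounded_operator (id : H -> H).
Proof. by split=> //; exists 1 => x; rewrite mul1r. Qed.

Lemma bop_scale (a : C) T : bounded_operator T ->
  bounded_operator (fun x => a *: T x).
Proof.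
move=> /bopP[lT [M M0 TM]]; split.
  by move=> b x y; rewrite lT scalerDr !scalerA mulrC.
have [r r0 ra] := normC_real a; exists (r * M) => x.
by rewrite normrZ ra rmorphM -mulrA ler_wpM2l// ler0c.
Qed.

Lemma bop_add T S : bounded_operator T -> bounded_operator S ->
  bounded_operator (fun x => T x + S x).
Proof.
move=> /bopP[lT [M M0 TM]] /bopP[lS [N N0 SN]]; split.
  by move=> b x y; rewrite lT lS scalerDr addrACA.
exists (M + N) => x; rewrite rmorphD mulrDl.
by rewrite (le_trans (ler_normD _ _))// lerD.
Qed.

Lemma bop_comp T S : bounded_operator T -> bounded_operator S ->
  bounded_operator (fun x => T (S x)).
Proof.
move=> /bopP[lT [M M0 TM]] /bopP[lS [N N0 SN]]; split.
  by move=> b x y; rewrite lS lT.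
exists (M * N) => x; rewrite rmorphM -mulrA (le_trans (TM _))//.
by rewrite ler_wpM2l// ler0c.
Qed.

Lemma bop_sub T S : bounded_operator T -> bounded_operator S ->
  bounded_operator (fun x => T x - S x).
Proof.
move=> bT bS; have := bop_add bT (bop_scale (-1) bS).
by congr bounded_operator; apply/funext => x; rewrite scaleN1r.
Qed.

Lemma dot_norm_le (x y : ell2 R) : `|dot x y| <= `|x| * `|y|.
Proof.
rewrite -ler_sqr ?qualifE/= ?mulr_ge0// exprMn !ell2_normE.
exact: (dot_CauchySchwarz (@dot R)).
Qed.

Lemma bop_rank1 (a b : ell2 R) : bounded_operator (fun x : H => dot x a *: b : H).
Proof.
split; first by move=> c x y; rewrite dot_linearl scalerDl scalerA.
have [s s0 sE] := ge0C_real (mulr_ge0 (normr_ge0 a) (normr_ge0 b)).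
exists s => x; rewrite normrZ -sE mulrAC ler_wpM2r//.
by rewrite mulrC dot_norm_le.
Qed.

Definition diag (d : nat -> C) : H -> H := fun x => of_seq (fun n => d n * entry x n).

Lemma entry_diag (d : nat -> C) (M : R) : (forall n, `|d n| <= M%:C) ->
  forall x n, entry (diag d x) n = d n * entry x n.
Proof.
move=> dM x n; rewrite entry_of_seq//; have /sqsumP[N xN] := entryP x.
apply/sqsumP; exists (M%:C ^+ 2 * N) => k; apply: le_trans (ler_wpM2l _ (xN k)).
  rewrite mulr_sumr; apply: ler_sum => i _; rewrite normrM exprMn ler_wpM2r ?exprn_ge0//.
  by rewrite lerXn2r ?qualifE//=; apply: le_trans (dM 0%N).
by rewrite exprn_ge0//; apply: le_trans (dM 0%N).
Qed.

Lemma bop_diag (d : nat -> C) (M : R) : (forall n, `|d n| <= M%:C) ->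
  bounded_operator (diag d).
Proof.
move=> dM; have M0 : 0 <= M%:C by apply: le_trans (dM 0%N).
split=> [a x y|].
  apply: ell2P => n; rewrite entryD entryZ !(entry_diag dM) entryD entryZ.
  by rewrite mulrDr mulrCA.
exists M => x; apply: ell2_norm_le; first by rewrite mulr_ge0.
move=> n; rewrite exprMn; apply: (@le_trans _ _
  (M%:C ^+ 2 * \sum_(0 <= k < n) `|entry x k| ^+ 2)).
  rewrite mulr_sumr; apply: ler_sum => i _; rewrite (entry_diag dM) normrM exprMn.
  by rewrite ler_wpM2r ?exprn_ge0// lerXn2r ?qualifE/=.
by rewrite ler_wpM2l ?exprn_ge0// entry_sum_le.
Qed.

(** On sequences supported in [N, oo) the rows from N on are diagonal with a bounded inverse. So the
    kernel is determined by its first N entries, and the first N basis vectors span a complement of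
    the range, possibly with redundancy. *)
Lemma fredholm_of_tail (N : nat) (d : nat -> C) (M : R) T : bounded_operator T ->
  (forall n, (N <= n)%N -> d n != 0 /\ `|(d n)^-1| <= M%:C) ->
  (forall x, (forall k, (k < N)%N -> entry x k = 0) ->
     forall n, (N <= n)%N -> entry (T x) n = d n * entry x n) ->
  fredholm T.
Proof.
move=> bT dM Td; have [lT _] := bT; split=> //.
  apply: le_lt_trans (ltry N%:R); apply: dimension_le.
    move=> n c u uT; rewrite /kernel /mkset.
    elim/big_ind : _ => [|x y Tx Ty|i _]; first exact: linear0_op.
      by have := lT 1 x y; rewrite !scale1r Tx Ty addr0.
    by have := lT (c i) (u i) 0; rewrite (linear0_op lT) !addr0 (uT i) scaler0.
  move=> x Tx x0; apply: ell2P => n; rewrite entry0.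
  have [nN|Nn] := ltnP n N; first exact: x0.
  have /eqP := Td x x0 n Nn; rewrite Tx entry0 eq_sym mulf_eq0.
  by rewrite (negPf (dM n Nn).1) => /eqP.
exists N, (fun i : 'I_N => ebasis i : H) => y.
pose g n := if (n < N)%N then 0 else (d n)^-1.
have gM n : `|g n| <= `|M|%:C.
  rewrite /g; case: ltnP => nN; first by rewrite normr0 ler0c.
  by apply: le_trans (dM n nN).2 _; rewrite lecR ler_norm.
(* The preimage vanishes below N and solves all rows from N on; the error left in the first N rows
   gives the coefficients. *)
exists (diag g y), (fun i : 'I_N => entry (y - T (diag g y)) i).
apply: ell2P => n; rewrite entryD entry_sum.
have gy k : (k < N)%N -> entry (diag g y) k = 0.
  by move=> kN; rewrite (entry_diag gM) /g kN mul0r.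
have [nN|Nn] := ltnP n N.
  rewrite (bigD1 (Ordinal nN)) //= big1 ?addr0 => [|i iN].
    by rewrite entryZ entry_ebasis eqxx mulr1 entryB addrC subrK.
  rewrite entryZ entry_ebasis; suff /negPf -> : n != i by rewrite mulr0.
  by apply: contra iN => /eqP ni; apply/eqP/val_inj.
rewrite big1 ?addr0 => [|i _]; last first.
  rewrite entryZ entry_ebasis; suff /negPf -> : n != i by rewrite mulr0.
  by rewrite gtn_eqF// (leq_trans (ltn_ord i)).
rewrite (Td _ gy n Nn) (entry_diag gM) /g ltnNge Nn /= mulrA mulfV ?mul1r//.
exact: (dM n Nn).1.
Qed.

Lemma op_derivative_unique (A : C -> H -> H) (w : C) B : is_op_derivative A w B ->
  op_derivative A w = B.
Proof.
move=> AB; apply: xget_unique => //= B' AB'; apply/funext => x.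
apply/eqP; rewrite -subr_eq0 -normr_le0; apply/ler_addgt0Pr => _ /gt0C_real[e e0 ->].
rewrite add0r; have [s s0 sx] := ge0C_real (normr_ge0 x).
(* Two remainders of slope d add up to at most e s / (s + 1) <= e; the 1 covers s = 0. *)
pose d := e / (2 * (s + 1)).
have d0 : 0 < d by rewrite divr_gt0// mulr_gt0// ltr_wpDl.
have /nbhs_ballP[a /gt0C_real[p p0 ->] pB] :=
  @filterI _ _ (nbhs_filter (0 : C)) _ _ (AB.2 d d0) (AB'.2 d d0).
have p20 : 0 < p / 2 by rewrite divr_gt0.
have [|/(_ x) h1 /(_ x) h2] := pB (p / 2)%:C.
  rewrite -ball_normE /= sub0r normrN normCR ltcR gtr0_norm//.
  by rewrite ltr_pdivrMr// ltr_pMr// ltr1n.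
have hp : 0 < `|(p / 2)%:C : C| by rewrite normCR ltcR gtr0_norm.
rewrite -(ler_pM2l hp) -normrZ scalerBr.
set X := A (w + _) x - A w x in h1 h2.
have -> : (p / 2)%:C *: B' x - (p / 2)%:C *: B x =
    (X - (p / 2)%:C *: B x) - (X - (p / 2)%:C *: B' x).
  by rewrite opprB [RHS]addrC [RHS]addrA subrK.
rewrite (le_trans (ler_normB _ _))// (le_trans (lerD h1 h2))//.
rewrite -mulrDl -mulrDl mulrAC mulrC ler_wpM2l// sx -rmorphD -rmorphM lecR.
rewrite /d; have -> : e / (2 * (s + 1)) + e / (2 * (s + 1)) = e / (s + 1).
  by field; rewrite gt_eqF// ltr_wpDl.
by rewrite mulrAC ler_pdivrMr ?ltr_wpDl// ler_wpM2l ?(ltW e0)// lerDl.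
Qed.

(** The Taylor remainder is exactly h^2 A2. *)
Lemma quadratic_derivative (A0 A1 A2 : H -> H) (w : C) :
  bounded_operator A1 -> bounded_operator A2 ->
  is_op_derivative (fun z x => A0 x + z *: A1 x + z ^+ 2 *: A2 x) w
    (fun x => A1 x + (2 * w) *: A2 x).
Proof.
move=> b1 b2; split; first exact: bop_add (bop_scale _ b2).
have [_ [M M0 A2M]] := bopP b2 => e e0.
have M1 : 0 < M + 1 by rewrite ltr_wpDl.
apply/nbhs_ballP; exists (e / (M + 1))%:C; first by rewrite /= ltcR divr_gt0.
move=> h; rewrite -ball_normE /= sub0r normrN => hM x.
have -> : A0 x + (w + h) *: A1 x + (w + h) ^+ 2 *: A2 x -
    (A0 x + w *: A1 x + w ^+ 2 *: A2 x) - h *: (A1 x + (2 * w) *: A2 x) =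
    (h * h) *: A2 x.
  by apply: ell2P => n; rewrite !entryE; ring.
rewrite normrZ normrM; have [s s0 sx] := ge0C_real (normr_ge0 h).
have [t t0 tx] := ge0C_real (normr_ge0 x).
rewrite sx ltcR in hM; rewrite sx tx.
apply: le_trans (ler_wpM2l _ (A2M x)) _; first by rewrite mulr_ge0 ?ler0c.
rewrite tx -!rmorphM lecR mulrA ler_wpM2r// -mulrA mulrC ler_wpM2r//.
rewrite ltr_pdivlMr// in hM; apply: le_trans (ltW hM).
by rewrite ler_wpM2l// lerDl.
Qed.

(** The line through [ebasis n] is described by vanishing entries, the form in which the kernel of
    A(0) is obtained in [kernel_limit_op]. *)
Lemma orth_proj_ebasis n x :
  orth_proj [set y : H | forall k, k != n -> entry y k = 0] x =
  entry x n *: (ebasis n : H).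
Proof.
have e0 : forall k, k != n -> entry (ebasis n) k = 0.
  by move=> k kn; rewrite entry_ebasis (negPf kn).
apply: xget_unique => /=.
  split=> [k kn|v v0]; first by rewrite entryZ e0// mulr0.
  rewrite /hdot /= /dot (csum_single (n := n)) => [|k kn].
    by rewrite entryB entryZ entry_ebasis eqxx mulr1 subrr mul0r.
  by rewrite v0// conjC0 mulr0.
move=> y [y0 /(_ _ e0)]; rewrite /hdot /= dot_ebasis entryB => /eqP.
rewrite subr_eq0 => /eqP xy; apply: ell2P => k; rewrite entryZ entry_ebasis.
by have [->|kn] := eqVneq k n; rewrite ?mulr1 ?mulr0// y0.
Qed.

End Ell2Operators.

Arguments ebasis R n%_N.

(** * A disc as test domain *)

Section Quadratic.
Variable R : realType.
Local Notation C := R[i].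
Implicit Types (a b c d : R) (z : C).

(** A class closed under both partial derivatives that contains the equations of circles, so that
    smoothness of every order is an induction. *)
Definition quadratic a b c d z : R :=
  a * (complex.Re z ^+ 2 + complex.Im z ^+ 2) + b * complex.Re z +
  c * complex.Im z + d.

Lemma quadratic_continuous a b c d : continuous (quadratic a b c d).
Proof.
move=> z; have F : Filter (nbhs z) by exact: nbhs_filter.
have re := @continuous_Re R z; have im := @continuous_Im R z.
apply: cvgD; [apply: cvgD; [apply: cvgD|]|exact: cvg_cst].
- apply: cvgM; first exact: cvg_cst.
  by apply: cvgD; under eq_cvg do rewrite expr2; rewrite expr2; apply: cvgM.
- by apply: cvgM => //; exact: cvg_cst.
- by apply: cvgM => //; exact: cvg_cst.
Qed.

Lemma is_derive_parabola a b c : is_derive (0 : R) (1 : R)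
  (fun t : R => a * t ^+ 2 + b * t + c) b.
Proof.
have -> : (fun t : R => a * t ^+ 2 + b * t + c) =
    horner (a *: 'X^2 + b *: 'X + c%:P).
  by apply/funext => t; rewrite !hornerE.
apply: is_derive_eq (is_derive_poly _ _) _.
rewrite derivD derivC addr0 derivD !derivZ derivXn derivX !hornerE /=.
by ring.
Qed.

Lemma line_x_quadratic a b c d z :
  is_derive (0 : R) (1 : R) (line_x (quadratic a b c d) z)
    (quadratic 0 (2 * a) 0 b z).
Proof.
have -> : line_x (quadratic a b c d) z = (fun t : R => a * t ^+ 2 +
    (2 * a * complex.Re z + b) * t + quadratic a b c d z).
  by apply/funext => t; case: z => x y; rewrite /line_x /quadratic /=; ring.
apply: is_derive_eq (is_derive_parabola _ _ _) _.
by rewrite /quadratic; ring.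
Qed.

Lemma line_y_quadratic a b c d z :
  is_derive (0 : R) (1 : R) (line_y (quadratic a b c d) z)
    (quadratic 0 0 (2 * a) c z).
Proof.
have -> : line_y (quadratic a b c d) z = (fun t : R => a * t ^+ 2 +
    (2 * a * complex.Im z + c) * t + quadratic a b c d z).
  apply/funext => t; case: z => x y; rewrite /line_y /quadratic.
  by rewrite -complexiE /=; ring.
apply: is_derive_eq (is_derive_parabola _ _ _) _.
by rewrite /quadratic; ring.
Qed.

Lemma partial_x_quadratic a b c d :
  partial_x (quadratic a b c d) = quadratic 0 (2 * a) 0 b.
Proof.
apply/funext => z; rewrite /partial_x derive1E.
exact: (@derive_val _ _ _ _ _ _ _ (line_x_quadratic a b c d z)).
Qed.

Lemma partial_y_quadratic a b c d :
  partial_y (quadratic a b c d) = quadratic 0 0 (2 * a) c.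
Proof.
apply/funext => z; rewrite /partial_y derive1E.
exact: (@derive_val _ _ _ _ _ _ _ (line_y_quadratic a b c d z)).
Qed.

Lemma smooth_quadratic U a b c d : smooth U (quadratic a b c d).
Proof.
move=> n; elim: n a b c d => [|n IHn] a b c d.
  by split=> // z _; exact: quadratic_continuous.
split; first by move=> z _; exact: quadratic_continuous.
rewrite partial_x_quadratic partial_y_quadratic; split=> [z _||]; [|exact: IHn..].
split.
  exact: (@ex_derive _ _ _ _ _ _ _ (line_x_quadratic a b c d z)).
exact: (@ex_derive _ _ _ _ _ _ _ (line_y_quadratic a b c d z)).
Qed.

End Quadratic.

Section UnitDisc.
Variable R : realType.
Local Notation C := R[i].
Implicit Types z w : C.

Definition test_disc : set C := ball (1 : C) (1 / 2 : R)%:C.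

Lemma test_discE z : test_disc z <-> `|z - 1| < (1 / 2 : R)%:C.
Proof. by rewrite /test_disc -ball_normE /= distrC. Qed.

Lemma test_disc_closure z : closure test_disc z -> `|z - 1| <= (1 / 2 : R)%:C.
Proof.
move=> cz; have cl : closed [set z : C | `|z - 1| <= (1 / 2 : R)%:C].
  by apply: compact_closed; [exact: norm_hausdorff|exact: compact_discC].
have : closure [set z : C | `|z - 1| <= (1 / 2 : R)%:C] z.
  by apply: closureS cz => y /test_discE/ltW.
by rewrite -((closure_id _).1 cl).
Qed.

Lemma star_connected (D : set C) w : D w ->
  (forall z (t : R), D z -> 0 <= t <= 1 -> D (w + t%:C * (z - w))) -> connected D.
Proof.
move=> Dw Dstar.
pose seg z : set C := (fun t : R => w + t%:C * (z - w)) @` `[0, 1]%classic.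
have -> : D = \bigcup_(z in D) seg z.
  apply/seteqP; split => [z zD|_ [z zD [t /= + <-]]].
    exists z => //; exists 1; first by rewrite /= in_itv /= ler01 lexx.
    by rewrite mul1r addrC subrK.
  by rewrite in_itv /= => t01; exact: Dstar.
apply: bigcup_connected => [|z _].
  exists w => z _; exists 0; first by rewrite /= in_itv /= ler01 lexx.
  by rewrite mul0r addr0.
apply: connected_continuous_connected; first exact: segment_connected.
apply: continuous_subspaceT => t; apply: cvgD; first exact: cvg_cst.
by apply: cvgM; [exact: continuous_realC|exact: cvg_cst].
Qed.

Lemma test_disc_domain : domain test_disc.
Proof.
have D1 : test_disc 1 by apply: ballxx; rewrite ltcR divr_gt0.
split; [exact: ball_open| |by exists 1].
apply: (@star_connected _ 1) => // z t /test_discE zD /andP[t0 t1].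
apply/test_discE; rewrite addrC addKr normrM; apply: le_lt_trans zD.
by rewrite ler_piMl// normCR ger0_norm// lecR.
Qed.

Lemma test_disc_compact : compact (closure test_disc).
Proof.
apply: subclosed_compact (@compact_discC R 1 (1 / 2)) test_disc_closure.
exact: closed_closure.
Qed.

Lemma test_disc_Re z : test_disc z -> 0 < complex.Re z.
Proof.
move=> /test_discE zD; have := le_lt_trans (normc_ge_Re _) zD.
by rewrite ltcR ReB /= ltr_distl => /andP[]; lra.
Qed.

Lemma test_disc0 : ~ closure test_disc 0.
Proof.
move=> /test_disc_closure; rewrite sub0r normrN normr1 lecR.
by move=> h; lra.
Qed.

Lemma test_disc_boundary_real x :
  real_trace (boundary test_disc) x -> `|x - 1| = 1 / 2.
Proof.
have eN : `|x%:C - 1| = `|x - 1|%:C :> C by rewrite -rmorphB normCR.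
move=> [/test_disc_closure + xN]; rewrite eN lecR le_eqVlt => /orP[/eqP//|x1].
exfalso; apply: xN; rewrite (interior_id _).1; last exact: ball_open.
by apply/test_discE; rewrite eN ltcR.
Qed.

Lemma test_disc_smooth : smooth_boundary_transverse test_disc.
Proof.
(* This is |z - 1|^2 - 1/4, a global defining function. Its gradient vanishes only at the centre,
   and on the real axis its x-derivative vanishes only there too; the centre is interior, hence not
   on the boundary. *)
move=> p pb; exists setT, (quadratic 1 (-2) 0 (3 / 4)).
have E z : `|z - 1| = (Num.sqrt ((complex.Re z - 1) ^+ 2 + complex.Im z ^+ 2))%:C.
  by case: z => x y; rewrite normc_def /= subr0.
have phiE z : (test_disc z <-> quadratic 1 (-2) 0 (3 / 4) z < 0).
  rewrite test_discE E ltcR -[X in _ < X]ger0_norm ?divr_ge0// -sqrtr_sqr.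
  rewrite ltr_sqrt; last by rewrite exprn_gt0 ?divr_gt0.
  by rewrite /quadratic; split; lra.
split=> //.
- by split; [exact: openT|].
- exact: smooth_quadratic.
- rewrite partial_x_quadratic partial_y_quadratic /quadratic.
  have [x1|x1] := eqVneq (complex.Re p) 1; last first.
    by left; apply: contra x1 => /eqP h; apply/eqP; lra.
  right; apply/negP => /eqP y0.
  have yy : complex.Im p = 0 by lra.
  apply: pb.2; rewrite (interior_id _).1; last exact: ball_open.
  by apply/phiE; rewrite /quadratic x1 yy; lra.
- move=> y0; rewrite partial_x_quadratic /quadratic; apply/negP => /eqP x0.
  apply: pb.2; rewrite (interior_id _).1; last exact: ball_open.
  have x1 : complex.Re p = 1 by lra.
  by apply/phiE; rewrite /quadratic x1 y0; lra.
Qed.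

End UnitDisc.

(** * Sparse spectrum without characteristic values refutes (C1) and (C2) *)

Section Refutation.
Variable R : realType.
Local Notation C := R[i].

Definition lam (n : nat) : R := if n is 0%N then 0 else (64 ^+ n)^-1.

Arguments lam : simpl never.

Lemma lamE n : (0 < n)%N -> lam n = (64 ^+ n)^-1. Proof. by case: n. Qed.

Lemma lam_gt0 n : (0 < n)%N -> 0 < lam n.
Proof. by move=> n0; rewrite lamE// invr_gt0 exprn_gt0. Qed.

Lemma lam_ge0 n : 0 <= lam n.
Proof. by case: n => // n; rewrite ltW// lam_gt0. Qed.

Lemma lam_decr m n : (0 < m < n)%N -> 64 * lam n <= lam m.
Proof.
move=> /andP[m0 mn]; rewrite !lamE//; last exact: leq_ltn_trans mn.
rewrite -[leRHS]mul1r ler_pdivlMr ?exprn_gt0// -mulrA mulrCA mulrC.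
rewrite ler_pdivrMr ?exprn_gt0// mul1r -exprS ler_eXn2l ?ltr1n//.
Qed.

Lemma lam_le n : (0 < n)%N -> lam n <= n%:R^-1.
Proof.
move=> n0; rewrite lamE// lef_pV2 ?posrE ?exprn_gt0 ?ltr0n// -natrX ler_nat.
exact/ltnW/ltn_expl.
Qed.

(** The quotient of two distinct eigenvalues is at least 64 or at most 1/64. This shows that the
    sets around the end points contain no eigenvalue. *)
Lemma lam_gap m n (c : R) : (0 < m)%N -> (0 < n)%N -> 1 / 64 < c < 64 ->
  lam n = lam m * c -> c = 1.
Proof.
move=> m0 n0 /andP[c1 c2] nm; have lm := lam_gt0 m0.
case: (ltngtP m n) => [mn|mn|mn].
- have := lam_decr (introT andP (conj m0 mn)); rewrite nm.
  by rewrite mulrCA -[leRHS]mulr1 ler_pM2l//; lra.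
- have := lam_decr (introT andP (conj n0 mn)); rewrite nm.
  by rewrite mulrC ler_pM2l//; lra.
- by apply: (mulfI (lt0r_neq0 lm)); rewrite mulr1 -nm mn.
Qed.

Lemma small_log (K : R) : 0 < K -> exists2 d0 : R, 0 < d0 &
  forall d, 0 < d < d0 -> K * d * `|ln d| ^+ 2 <= 1 / 2.
Proof.
move=> K0; pose e := Num.min 1 (1 / (32 * K)).
have e0 : 0 < e by rewrite lt_min ltr01 divr_gt0// mulr_gt0.
exists (e ^+ 2); first by rewrite exprn_gt0.
(* With d = t^4 and |ln t| <= 1 / t, the quantity is at most 16 K t^2, and t^2 < 1 / (32 K). *)
move=> d /andP[dp de]; pose t := Num.sqrt (Num.sqrt d).
have t0 : 0 < t by rewrite !sqrtr_gt0.
have dt : d = t ^+ 4.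
  by rewrite (exprM t 2 2) !sqr_sqrtr// ltW// sqrtr_gt0.
have te : t ^+ 2 < e.
  rewrite -(@ltr_pXn2r _ 2) ?qualifE//= ?exprn_ge0 ?(ltW e0) ?(ltW t0)//.
  by rewrite -exprM -dt.
have t1 : t < 1.
  rewrite -(@ltr_pXn2r _ 2) ?qualifE//= ?(ltW t0)// expr1n.
  by apply: lt_le_trans te _; rewrite ge_min lexx.
have lt : `|ln t| <= t^-1.
  rewrite ltr0_norm ?ln_lt0 ?t0// -lnV ?qualifE//=.
  by apply/ltW/ln_sublinear; rewrite invr_gt0.
have ld : `|ln d| ^+ 2 <= 16 * t ^- 2.
  have -> : `|ln d| = 4 * `|ln t| by rewrite dt lnXn// normrMn mulr_natl.
  rewrite exprMn -exprVn -natrX.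
  by rewrite ler_wpM2l// lerXn2r ?qualifE//= invr_ge0 ltW.
have Kd : 0 <= K * d by rewrite mulr_ge0// ltW.
apply: le_trans (ler_wpM2l Kd ld) _.
have -> : K * d * (16 * t ^- 2) = 16 * K * t ^+ 2.
  by rewrite dt; field; rewrite gt_eqF.
have : t ^+ 2 <= 1 / (32 * K).
  by apply: le_trans (ltW te) _; rewrite ge_min lexx orbT.
rewrite ler_pdivlMr ?mulr_gt0//; lra.
Qed.

Variables (H : hilbertSpace R) (A : C -> H -> H).
(* No characteristic value lies in the half-plane Re z > 0, while the positive
   eigenvalues of A(0) are the numbers 64^-n with n >= 1. *)
Hypothesis A_inv : forall z : C, 0 < complex.Re z -> invertible (Fop A z).
Hypothesis A_mult0 : forall l : R, 0 < l -> (forall n, (0 < n)%N -> l <> lam n) ->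
  algebraic_multiplicity (A 0) l%:C = 0%E.
Hypothesis A_mult : forall n, (0 < n)%N ->
  (1 <= algebraic_multiplicity (A 0%R) (lam n)%:C < +oo)%E.

Lemma mult_ge0 (l : C) : (0 <= algebraic_multiplicity (A 0%R) l)%E.
Proof.
apply: ereal_sup_ubound; exists 0%N => //=; exists (fun=> 0).
by split=> [[]|c _ []].
Qed.

Lemma Ncount0 (D Omega : set C) : (forall z, Omega z -> 0 < complex.Re z) ->
  Ncount D A Omega = 0%E.
Proof.
move=> Om; rewrite /Ncount [X in esum X _](_ : _ = set0) ?esum_set0//.
apply/seteqP; split => // z [[_ _ zA] [Oz _]].
by apply: zA; apply: A_inv; exact: Om.
Qed.

Lemma ncount0 (L : set R) :
  (forall l, L l -> 0 < l /\ forall n, (0 < n)%N -> l <> lam n) ->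
  ncount A L = 0%E.
Proof. by move=> L0; apply: esum1 => l /L0[l0 ln]; exact: A_mult0. Qed.

Lemma ncount_ge1 (L : set R) n : (0 < n)%N -> L (lam n) -> (1 <= ncount A L)%E.
Proof.
move=> n0 Ln; apply: esum_ge; exists [set lam n].
  by split; [exact: finite_set1|move=> _ ->].
by rewrite fsbig_set1; have /andP[] := A_mult n0.
Qed.

(** The positive eigenvalues in this segment are exactly lam 1, ..., lam m. Finiteness is as
    essential as the lower bound: an infinite count would satisfy the inequality in (C2). *)
Lemma ncount_segment m : (0 < m)%N ->
  (m%:R%:E <= ncount A `[(lam m / 2)%R, 1%R] < +oo)%E.
Proof.
move=> m0; set L := [set` _].
pose s := [seq lam k.+1 | k <- iota 0 m].
have lam_inj i j : lam i.+1 = lam j.+1 -> i = j.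
  move=> ij; case: (ltngtP i j) => // h; exfalso.
    have := @lam_decr i.+1 j.+1 h; have := @lam_gt0 j.+1 isT; lra.
  have := @lam_decr j.+1 i.+1 h; have := @lam_gt0 j.+1 isT; lra.
have us : uniq s by rewrite map_inj_uniq ?iota_uniq.
have sL : [set` s] `<=` L.
  move=> _ /mapP[k + ->]; rewrite mem_iota add0n => /= km.
  rewrite /L /= in_itv /=; have k0 := @lam_gt0 k.+1 isT.
  have k1 : lam k.+1 <= 1 by rewrite (le_trans (lam_le _))// invf_le1 ?ler1n ?ltr0n.
  rewrite k1 andbT; have [<-|mk] := eqVneq k.+1 m; first by lra.
  have km' : (k.+1 < m)%N by rewrite ltn_neqAle mk km.
  have := @lam_decr k.+1 m km'.
  have := lam_gt0 m0; lra.
have -> : (ncount A L = \sum_(l <- s) algebraic_multiplicity (A 0%R) l%:C)%E.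
  rewrite /ncount (esumID [set` s]); last by move=> l _; exact: mult_ge0.
  rewrite (setIidr sL) [X in (_ + X)%E]esum1 ?adde0; last first.
    move=> l [+ ls]; rewrite /L /= in_itv /= => /andP[ml _].
    have lm := lam_gt0 m0.
    apply: A_mult0 => [|n n0 ln]; first by lra.
    apply: ls; rewrite /= ln; apply/mapP; exists n.-1; last by rewrite prednK.
    rewrite mem_iota add0n /= prednK//; rewrite leqNgt; apply/negP => mn.
    have := @lam_decr m n; rewrite m0 mn => /(_ isT); lra.
  rewrite esum_fset; [|exact: finite_seq|by move=> l _; exact: mult_ge0].
  by rewrite -fsbig_seq.
rewrite big_map; apply/andP; split.
  rewrite -[X in X%:R](size_iota 0 m); elim: (iota 0 m) => [|k t IH].
    by rewrite big_nil.
  rewrite big_cons /= -natr1 EFinD addrC; apply: leeD => //.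
  by have /andP[] := @A_mult k.+1 isT.
by apply: lte_sum_pinfty => k _; have /andP[] := @A_mult k.+1 isT.
Qed.

(* With s = 64^-m, only 64^-m lies in s(1/2, 3/2), and no eigenvalue is close to
   the end points. *)
Lemma not_small_domains (D : set C) : ~ concl_small_domains D A.
Proof.
move=> /(_ _ (test_disc_domain R) (@test_disc_compact R) (@test_disc0 R)
  (@test_disc_smooth R)) [K [d1 [K0 d10 main]]].
(* With delta <= 1/8 the set I_delta lies in the union of [3/8, 5/8] and [11/8, 13/8], which is
   inside (1/64, 64) and avoids 1. *)
pose d := Num.min (d1 / 2) (1 / 8).
have d0 : 0 < d by rewrite lt_min !divr_gt0.
have dd1 : d < d1 by rewrite gt_min ltr_pdivrMr// ltr_pMr// ltr1n.
have d8 : d <= 1 / 8 by rewrite ge_min lexx orbT.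
have [|s s0 {}main] := main d; first by rewrite d0.
pose m := (Num.truncn s^-1).+1.
have ms : lam m < s.
  apply: le_lt_trans (lam_le _) _ => //; rewrite -[ltRHS]invrK ltf_pV2.
  - exact: truncnS_gt.
  - by rewrite posrE ltr0n.
  - by rewrite posrE invr_gt0.
have lm : 0 < lam m by exact: lam_gt0.
have [|_] := main (lam m); first by rewrite lm.
rewrite Ncount0; last first.
  move=> _ [z /test_disc_Re z0 <-]; case: z z0 => x y /= x0.
  by rewrite mul0r subr0 mulr_gt0.
rewrite [X in (_ * X)%E]ncount0 ?mule0 ?adde0; last first.
  move=> _ [_ [x /test_disc_boundary_real x1] [t + <-] <-].
  rewrite /= in_itv /= -ler_norml => td.
  have [c0 c1 cN] : [/\ 1 / 64 < x + t, x + t < 64 & x + t != 1].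
    have {}td : `|t| <= 1 / 8 by exact: le_trans td d8.
    move: td x1; rewrite ler_norml => /andP[t1 t2].
    have [x1|x1] := lerP 0 (x - 1); rewrite ?(ger0_norm x1) ?(ltr0_norm x1) => e.
      by split; [lra|lra|apply/negP => /eqP; lra].
    by split; [lra|lra|apply/negP => /eqP; lra].
  split; first by rewrite mulr_gt0//; lra.
  move=> n n0 ln; move/eqP: cN; apply; apply: (@lam_gap m n) => //.
  by rewrite c0.
move=> n0; suff h : (1 <= ncount A [set (lam m * x)%R | x in real_trace (@test_disc R)])%E.
  by have := le_trans h n0; rewrite lee_fin ler10.
apply: (@ncount_ge1 _ m) => //; exists 1; last by rewrite mulr1.
by rewrite /real_trace /=; apply: ballxx; rewrite ltcR divr_gt0.
Qed.

(* With r = 64^-m / 2 there is no eigenvalue near r, so that (C2) would give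
   n([r, 1]) <= n([r, 1]) / 2 + C_delta, although n([r, 1]) >= m. *)
Lemma not_sectors : ~ concl_sectors setT A.
Proof.
move=> /(_ 1 ltr01) [//|K [d1 [K0 d10 main]]].
have [d2 d20 smallK] := small_log K0.
pose d := Num.min (Num.min d1 d2) (1 / 4) / 2.
have d0 : 0 < d by rewrite divr_gt0// !lt_min d10 d20 divr_gt0.
have dmin : d < Num.min (Num.min d1 d2) (1 / 4).
  by rewrite ltr_pdivrMr// ltr_pMr ?ltr1n// !lt_min d10 d20 divr_gt0.
move: dmin; rewrite !lt_min => /andP[/andP[dd1 dd2] d4].
have [|r [Kd [r0 Kd0 {}main]]] := main d; first by rewrite d0.
have {}smallK := smallK d (introT andP (conj d0 dd2)).
(* Since m > 1 / r, the point lam m / 2 is below the threshold [r]; since m > 2 [Kd], a count x >= m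
   cannot satisfy x <= x / 2 + [Kd]. *)
pose m := (Num.truncn (r^-1 + 2 * Kd)).+1.
have mM : r^-1 + 2 * Kd < m%:R by exact: truncnS_gt.
have ri : 0 < r^-1 by rewrite invr_gt0.
have lm : 0 < lam m by exact: lam_gt0.
have mr : lam m / 2 < r.
  have : lam m < r.
    apply: le_lt_trans (lam_le _) _ => //; rewrite -[ltRHS]invrK ltf_pV2 ?posrE//.
    by lra.
  lra.
have [|_] := main (lam m / 2); first by rewrite divr_gt0.
rewrite Ncount0; last first.
  by move=> z [/andP[rz _] _]; apply: lt_le_trans rz; rewrite divr_gt0.
rewrite add0e [X in (_ + _ * X + _)%E]ncount0 ?mule0 ?adde0; last first.
  move=> l; rewrite /= in_itv /= => /andP[l1 l2].
  pose c := l / lam m.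
  have lc : l = lam m * c by rewrite mulrC divfK// gt_eqF.
  have c1 : 1 / 2 * (1 - d) <= c by rewrite ler_pdivlMr//; lra.
  have c2 : c <= 1 / 2 * (1 + d) by rewrite ler_pdivrMr//; lra.
  split; first by rewrite lc mulr_gt0//; lra.
  move=> n n0 ln; have : c = 1.
    by apply: (@lam_gap m n) => //; [apply/andP; split; lra|rewrite -ln].
  by lra.
have /andP[] := @ncount_segment m isT.
case: (ncount A _) => [x| |]; rewrite ?lee_fin //.
move=> mx _ xK; have : K * d * `|ln d| ^+ 2 * x <= 1 / 2 * x.
  by rewrite ler_wpM2r// (le_trans _ mx).
lra.
Qed.

End Refutation.

(** * The determinant of the coupled systems *)

Section ResolventEstimate.
Variable R : realType.
Local Notation C := R[i].
Local Notation H := (ell2_hilbert R).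
Local Notation lam := (@lam R).
Implicit Types (z : C) (n m k : nat).

Lemma geometric_le n : \sum_(0 <= k < n) (64^-1 : R) ^+ k <= 64 / 63.
Proof.
have := subrX1 (64^-1 : R) n; rewrite -(big_mkord xpredT (fun k => 64^-1 ^+ k)).
set S := \sum_(0 <= k < n) _ => e.
have : 0 <= (64^-1 : R) ^+ n by rewrite exprn_ge0.
lra.
Qed.

Lemma lamD i j : (0 < i)%N -> lam (i + j) = lam i * 64^-1 ^+ j.
Proof. by move=> i0; rewrite !lamE ?addn_gt0 ?i0// exprD invfM exprVn. Qed.

Lemma lam_le1 n : lam n <= 1.
Proof.
case: n => [|n]; first exact: ler01.
by rewrite (le_trans (lam_le _ _))// invf_le1 ?ler1n ?ltr0n.
Qed.

(* The signs in useq make the residues 2 (-1)^n 64^-n of the Schur complement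
   1 - sum_n useq n * vseq n / (z - lam n) such that it is approximately
   (-1)^(n - 1) (z + lam n) / (z - lam n) for z of size lam n. *)
Definition vseq n : R := if n is 0%N then 0 else (8 ^+ n)^-1.
Definition useq n : R := 2 * (-1) ^+ n * vseq n.

Arguments vseq : simpl never.

Lemma vseqE n : (0 < n)%N -> vseq n = (8 ^+ n)^-1. Proof. by case: n. Qed.

Lemma sqr_vseq n : vseq n ^+ 2 = lam n.
Proof.
case: n => [|n]; first by rewrite /vseq /= expr0n.
by rewrite vseqE// lamE// exprVn -exprM mulnC exprM; congr ((_ ^+ _)^-1); lra.
Qed.

Lemma vseq_ge0 n : 0 <= vseq n.
Proof. by case: n => // n; rewrite vseqE// invr_ge0 exprn_ge0. Qed.

Lemma sum_lam_le n : \sum_(0 <= k < n) lam k <= 2.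
Proof.
apply: (@le_trans _ _ (64 / 63)); last by lra.
apply: le_trans (geometric_le n); apply: ler_sum => -[|k] _.
  exact: ler01.
by rewrite lamE// exprVn.
Qed.

Lemma vseq_sqsum (c : R) (s : nat -> R) : (forall n, `|s n| <= c) ->
  (fun n => (s n * vseq n)%:C) \in @sqsum R.
Proof.
move=> sc; have c0 : 0 <= c by apply: le_trans (sc 0%N).
apply/sqsumP; exists (c ^+ 2 * 2)%:C => n.
rewrite (eq_bigr (fun k => (`|s k| ^+ 2 * lam k)%:C)) => [|k _]; last first.
  rewrite normCR normrM -rmorphXn exprMn -sqr_vseq; congr (_ * _)%:C.
  by rewrite real_normK// num_real.
rewrite -rmorph_sum lecR; apply: (@le_trans _ _ (c ^+ 2 * \sum_(0 <= k < n) lam k)).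
  rewrite mulr_sumr; apply: ler_sum => k _; apply: ler_wpM2r; first exact: lam_ge0.
  by rewrite lerXn2r ?qualifE/=.
by rewrite ler_wpM2l ?exprn_ge0// sum_lam_le.
Qed.

(** The factor 1 gives [vvec] the shape handled by [vseq_sqsum]. *)
Definition vvec : H := of_seq (fun n => (1 * vseq n)%:C).
Definition uvec : H := of_seq (fun n => (2 * (-1) ^+ n * vseq n)%:C).

Lemma entry_vvec n : entry vvec n = (vseq n)%:C.
Proof.
rewrite entry_of_seq ?mul1r//; apply: (@vseq_sqsum 1 (fun=> 1)) => k.
by rewrite normr1.
Qed.

Lemma entry_uvec n : entry uvec n = (useq n)%:C.
Proof.
rewrite entry_of_seq//; apply: (@vseq_sqsum 2 (fun n => 2 * (-1) ^+ n)) => k.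
by rewrite normrM normrX normrN1 expr1n mulr1 ger0_norm.
Qed.

Lemma uv_lam n : useq n * vseq n = 2 * (-1) ^+ n * lam n.
Proof. by rewrite -sqr_vseq /useq; ring. Qed.

Lemma conjCR (x : R) : ((x%:C : C)^* )%R = x%:C.
Proof. by apply: conj_Creal; rewrite complex_real. Qed.

(* Every z is compared with the largest eigenvalue lam m which is at most 8 |z|;
   all the other eigenvalues are then far from z. *)
Section Window.
Variables (z : C) (r : R) (m : nat).
Hypotheses (z_gt0 : 0 < complex.Re z) (rz : `|z| = r%:C).
Hypotheses (m_gt0 : (0 < m)%N) (m_le : lam m <= 8 * r).
Hypothesis m_min : forall k, (0 < k < m)%N -> 8 * r < lam k.

Let r_gt0 : 0 < r.
Proof.
rewrite -ltcR -rz normr_gt0; apply: contraTneq z_gt0 => ->.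
by rewrite /= ltxx.
Qed.

(** One factor 64 takes the bound 8 r to r / 8, which explains the predecessor in the exponent. The
    constant 8, the square root of the ratio, treats the eigenvalues on both sides of the window
    alike. *)
Lemma window_small k : (m < k)%N ->
  lam k <= 64^-1 ^+ (k - m).-1 / 8 * r.
Proof.
move=> mk; have -> : k = (m + (k - m).-1.+1)%N by lia.
rewrite lamD// exprS.
have -> : ((m + (k - m).-1.+1 - m).-1 = (k - m).-1)%N by lia.
have := ler_wpM2r (exprn_ge0 (k - m).-1 (_ : 0 <= 64^-1 :> R)) m_le.
rewrite invr_ge0 ler0n => /(_ isT); lra.
Qed.

Lemma window_large k : (0 < k < m)%N ->
  r <= 64^-1 ^+ (m - k).-1 / 8 * lam k.
Proof.
move=> /andP[k0 km].
have m1 : 8 * r < lam m.-1 by apply: m_min; lia.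
have e : m.-1 = (k + (m - k).-1)%N by lia.
rewrite e lamD// in m1; lra.
Qed.

Lemma norm_sub_ge k : (lam k)%:C - `|z| <= `|z - (lam k)%:C| /\
  `|z| - (lam k)%:C <= `|z - (lam k)%:C|.
Proof.
have e : `|(lam k)%:C : C| = (lam k)%:C by rewrite normCR ger0_norm// lam_ge0.
by split; rewrite -{1}e; [rewrite [leRHS]distrC|]; exact: lerB_dist.
Qed.

Lemma window_dist_small k : (m < k)%N -> (7 / 8 * r)%:C <= `|z - (lam k)%:C|.
Proof.
move=> mk; apply: le_trans (norm_sub_ge k).2; rewrite rz -rmorphB lecR.
have := window_small mk.
have : 64^-1 ^+ (k - m).-1 <= 1 :> R by rewrite exprn_ile1 ?invr_ge0// invf_le1// ler1n.
move=> /(ler_wpM2r (ltW r_gt0)); lra.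
Qed.

Lemma window_dist_large k : (0 < k < m)%N ->
  (7 / 8 * lam k)%:C <= `|z - (lam k)%:C|.
Proof.
move=> km; apply: le_trans (norm_sub_ge k).1; rewrite rz -rmorphB lecR.
have := window_large km.
have : 64^-1 ^+ (m - k).-1 <= 1 :> R by rewrite exprn_ile1 ?invr_ge0// invf_le1// ler1n.
move=> /(ler_wpM2r (lam_ge0 R k)); lra.
Qed.

(* The resolvent with the rows 0 and m removed. *)
Definition gres n : C := if (n == 0%N) || (n == m) then 0 else z / (z - (lam n)%:C).

Lemma window_cases n : n != 0%N -> n != m -> (m < n)%N \/ (0 < n < m)%N.
Proof. by move=> n0 nm; lia. Qed.

Lemma gres_neq0 n : n != 0%N -> n != m -> z - (lam n)%:C != 0.
Proof.
move=> n0 nm; rewrite -normr_gt0; case: (window_cases n0 nm) => h.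
  by apply: lt_le_trans (window_dist_small h); rewrite ltcR mulr_gt0.
apply: lt_le_trans (window_dist_large h); rewrite ltcR mulr_gt0// lam_gt0//.
by case/andP: h.
Qed.

Lemma gres_le n : `|gres n| <= 2%:C.
Proof.
rewrite /gres; case: ifPn => [_|]; first by rewrite normr0 ler0c.
rewrite negb_or => /andP[n0 nm]; rewrite normrM normfV.
have zl : 0 < `|z - (lam n)%:C| by rewrite normr_gt0 gres_neq0.
rewrite ler_pdivrMr// rz; case: (window_cases n0 nm) => h.
  apply: le_trans (ler_wpM2l _ (window_dist_small h)); rewrite ?ler0c//.
  by rewrite -rmorphM lecR; have := r_gt0; lra.
apply: le_trans (ler_wpM2l _ (window_dist_large h)); rewrite ?ler0c//.
rewrite -rmorphM lecR; have := m_min h; have := r_gt0; lra.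
Qed.

Lemma alternating_sum j : (0 < j)%N ->
  1 + \sum_(1 <= k < j) 2 * (-1) ^+ k = - (-1) ^+ j :> R.
Proof.
elim: j => // -[|j] IH _; first by rewrite big_geq// addr0 expr1 opprK.
by rewrite big_nat_recr//= addrA IH// !exprS; ring.
Qed.

(** The terms of the series for [1 - schur]; off 0 and m they equal u_k v_k / (z - lam k). *)
Definition resid k : C := entry vvec k * gres k / z * ((entry uvec k)^*)%R.

Let z_neq0 : z != 0.
Proof. by rewrite -normr_gt0 rz ltcR. Qed.

Lemma residE k : k != 0%N -> k != m ->
  resid k = (2 * (-1) ^+ k * lam k)%:C / (z - (lam k)%:C).
Proof.
move=> k0 km; rewrite /resid entry_vvec entry_uvec conjCR /gres.
rewrite (negPf k0) (negPf km) /=.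
rewrite -uv_lam [X in _ = X / _]rmorphM /=; have := gres_neq0 k0 km.
move: (useq k)%:C (vseq k)%:C (lam k)%:C => u v l zl; have z0 := z_neq0.
by field; rewrite z0 zl.
Qed.

Lemma resid0 k : (k == 0%N) || (k == m) -> resid k = 0.
Proof. by move=> h; rewrite /resid /gres h mulr0 !mul0r. Qed.

Lemma resid_small k : (m < k)%N -> `|resid k| <= (2 / 7 * 64^-1 ^+ (k - m).-1)%:C.
Proof.
move=> mk; have k0 : k != 0%N by lia.
have km : k != m by lia.
have zl : 0 < `|z - (lam k)%:C| by rewrite normr_gt0 gres_neq0.
rewrite residE// normrM normfV ler_pdivrMr//.
apply: le_trans (ler_wpM2l _ (window_dist_small mk)); last first.
  by rewrite ler0c mulr_ge0// exprn_ge0// invr_ge0.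
rewrite -rmorphM normCR lecR !normrM normrX normrN1 expr1n.
rewrite (ger0_norm (lam_ge0 R k)) ger0_norm//; have := window_small mk; lra.
Qed.

(** Adding 2 (-1)^k to 2 (-1)^k lam k / (z - lam k) leaves 2 (-1)^k z / (z - lam k), small because
    lam k dominates z. The constant 2/7 is 2 (1/8) / (7/8). *)
Lemma resid_large k : (0 < k < m)%N ->
  `|(2 * (-1) ^+ k)%:C + resid k| <= (2 / 7 * 64^-1 ^+ (m - k).-1)%:C.
Proof.
move=> mk; have k0 : k != 0%N by lia.
have km : k != m by lia.
have zl := gres_neq0 k0 km.
have zl0 : 0 < `|z - (lam k)%:C| by rewrite normr_gt0.
rewrite residE//.
have -> : (2 * (-1) ^+ k)%:C + (2 * (-1) ^+ k * lam k)%:C / (z - (lam k)%:C) =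
    (2 * (-1) ^+ k)%:C * z / (z - (lam k)%:C).
  by rewrite rmorphM; field.
rewrite normrM normfV ler_pdivrMr//.
apply: le_trans (ler_wpM2l _ (window_dist_large mk)); last first.
  by rewrite ler0c mulr_ge0// exprn_ge0// invr_ge0.
rewrite normrM rz normCR -!rmorphM lecR normrM normrX normrN1 expr1n.
rewrite ger0_norm//; have := window_large mk; lra.
Qed.

Lemma geometric_small n : \sum_(m.+1 <= k < n) (64^-1 : R) ^+ (k - m).-1 <= 64 / 63.
Proof.
apply: le_trans (geometric_le (n - m.+1)).
rewrite -{1}(add0n m.+1) big_addn; rewrite le_eqVlt; apply/orP; left.
apply/eqP; apply: eq_bigr => k _.
by congr (_ ^+ _); lia.
Qed.

Lemma geometric_large : \sum_(1 <= k < m) (64^-1 : R) ^+ (m - k).-1 <= 64 / 63.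
Proof.
apply: le_trans (geometric_le m.-1).
rewrite big_nat_rev /= -{1}(add0n 1%N) big_addn subn1 !big_nat.
rewrite le_eqVlt; apply/orP; left; apply/eqP.
by apply: eq_bigr => k /andP[_ km]; congr (_ ^+ _); lia.
Qed.

(** By [alternating_sum], 1 + (-1)^m cancels the limiting values of the terms with k < m; the errors
    on the two sides of m are geometric and sum to at most 2 (2/7) (64/63) < 3/5. *)
Lemma resid_sum n : (m < n)%N ->
  `|1 + (-1) ^+ m - \sum_(0 <= k < n) resid k| <= (3 / 5)%:C.
Proof.
move=> mn.
have -> : \sum_(0 <= k < n) resid k =
    \sum_(1 <= k < m) resid k + \sum_(m.+1 <= k < n) resid k.
  rewrite big_ltn ?(leq_ltn_trans (leq0n m))// resid0// add0r.
  rewrite (big_cat_nat m_gt0 (ltnW mn)) /=; congr (_ + _).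
  by rewrite big_ltn// resid0 ?eqxx ?orbT// add0r.
have -> : 1 + (-1) ^+ m = - \sum_(1 <= k < m) (2 * (-1) ^+ k)%:C :> C.
  have e : - \sum_(1 <= k < m) 2 * (-1) ^+ k = 1 + (-1) ^+ m :> R.
    by have := alternating_sum m_gt0; lra.
  have -> : 1 + (-1) ^+ m = (1 + (-1) ^+ m : R)%:C :> C.
    by rewrite rmorphD rmorph1 rmorphXn rmorphN1.
  by rewrite -e raddfN raddf_sum.
rewrite opprD addrA -opprD -big_split /=.
apply: le_trans (ler_normB _ _) _; rewrite normrN.
apply: (@le_trans _ _ ((2 / 7 * (64 / 63))%:C + (2 / 7 * (64 / 63))%:C)); last first.
  by rewrite -rmorphD lecR; lra.
apply: lerD; apply: le_trans (ler_norm_sum _ _ _) _.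
  apply: (@le_trans _ _ (\sum_(1 <= k < m) (2 / 7 * 64^-1 ^+ (m - k).-1)%:C)).
    by rewrite !big_nat; apply: ler_sum => k; exact: resid_large.
  rewrite -rmorph_sum lecR -mulr_sumr ler_wpM2l ?divr_ge0//.
  exact: geometric_large.
apply: (@le_trans _ _ (\sum_(m.+1 <= k < n) (2 / 7 * 64^-1 ^+ (k - m).-1)%:C)).
  by rewrite !big_nat; apply: ler_sum => k /andP[mk _]; exact: resid_small.
rewrite -rmorph_sum lecR -mulr_sumr ler_wpM2l ?divr_ge0//.
exact: geometric_small.
Qed.

(** The coefficient of the entry 0 in row 0 after elimination of every entry other than 0 and m. *)
Definition schur : C := 1 - dot (diag gres vvec) uvec / z.

Lemma schur_near : `|schur + (-1) ^+ m| <= (3 / 5)%:C.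
Proof.
have cv := csummable_cvg (csummable_dot (diag gres vvec) uvec).
have rcv : (fun n => z^-1 * series (fun n => entry (diag gres vvec) n *
    ((entry uvec n)^*)%R) n) @ \oo --> z^-1 * dot (diag gres vvec) uvec.
  by apply: (@cvgM _ nat _ _ (cst z^-1) _ _ _ _ cv); exact: cvg_cst.
have -> : schur + (-1) ^+ m = 1 + (-1) ^+ m - z^-1 * dot (diag gres vvec) uvec.
  by rewrite /schur addrAC [in RHS]mulrC.
apply: (@dist_cvg_le _ _ _ _ _ _ m.+1 rcv) => n mn.
rewrite /series /= mulr_sumr; apply: le_trans (resid_sum mn).
rewrite [X in _ - X](_ : _ = \sum_(0 <= k < n) resid k)//.
apply: eq_bigr => k _; rewrite (entry_diag gres_le) /resid; ring.
Qed.

(* Determinant of the 2x2 system for the entries 0 and m left once the other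
   entries are eliminated; this avoids a special treatment of z = lam m. *)
Definition window_det : C :=
  schur * (1 - (lam m)%:C / z) - (useq m * vseq m)%:C / z.

Lemma norm_sub_le_add (l : R) : 0 < l -> `|z - l%:C| <= `|z + l%:C|.
Proof.
move=> l0; case: (z) z_gt0 => x y /= x0; rewrite !normc_def /= lecR.
rewrite ler_wsqrtr// addr0 subr0 lerD2r -subr_ge0.
have -> : (x + l) ^+ 2 - (x - l) ^+ 2 = 4 * (x * l) by ring.
by rewrite mulr_ge0// mulr_ge0// ltW.
Qed.

Lemma window_det_neq0 : window_det != 0.
Proof.
have lm := lam_gt0 R m_gt0; apply/negP => /eqP d0.
(* In general z [window_det] = (schur + (-1)^m) (z - lam m) - (-1)^m (z + lam m). At a zero, |z +
   lam m| would be at most 3/5 |z - lam m|, although z is closer to lam m than to - lam m. *)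
have e : (-1) ^+ m * (z + (lam m)%:C) =
    (schur + (-1) ^+ m) * (z - (lam m)%:C).
  have : z * window_det = 0 by rewrite d0 mulr0.
  rewrite /window_det uv_lam !rmorphM rmorphXn rmorphN1 (rmorph_nat _ 2) => zd.
  apply/eqP; rewrite -subr_eq0 -oppr_eq0 -[X in _ == X]zd; apply/eqP.
  by field.
have : `|z + (lam m)%:C| <= (3 / 5)%:C * `|z + (lam m)%:C|.
  rewrite -[leLHS]mul1r -(expr1n _ m) -(normrN1 C) -normrX -normrM e normrM.
  by apply: ler_pM => //; [exact: schur_near|exact: norm_sub_le_add].
have : 0 < `|z + (lam m)%:C|.
  rewrite normr_gt0; apply: contraTneq z_gt0 => /(congr1 (@complex.Re R)).
  by rewrite ReD /= => h; rewrite -leNgt; lra.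
have [s s0 ->] := normC_real (z + (lam m)%:C).
rewrite -rmorphM lecR ltcR; lra.
Qed.

End Window.
End ResolventEstimate.

(** * The three families *)

Section Families.
Variable R : realType.
Local Notation C := R[i].
Local Notation H := (ell2_hilbert R).
Local Notation lam := (@lam R).
Local Notation u := (uvec R).
Local Notation v := (vvec R).
Local Notation e0 := (ebasis R 0 : H).
Implicit Types (z c : C) (x y w : H) (n m k : nat).

Definition lamdiag : H -> H := diag (fun n => (lam n)%:C).

Lemma lam0 : lam 0 = 0. Proof. by []. Qed.

Lemma norm_lam_le n : `|(lam n)%:C : C| <= 1%:C.
Proof. by rewrite normCR lecR ger0_norm ?lam_ge0 ?lam_le1. Qed.

Lemma entry_lamdiag x n : entry (lamdiag x) n = (lam n)%:C * entry x n.
Proof. exact: entry_diag norm_lam_le x n. Qed.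

Lemma entry_e0 n : entry e0 n = (n == 0%N)%:R. Proof. exact: entry_ebasis. Qed.

Lemma dot_e0 x : dot x e0 = entry x 0. Proof. exact: dot_ebasis. Qed.

Lemma dot_u_tail0 x : (forall n, n != 0%N -> entry x n = 0) -> dot x u = 0.
Proof.
move=> x0; rewrite /dot (csum_single (n := 0%N)) => [|n /x0 ->].
  by rewrite entry_uvec /useq /= mulr0 conjC0 mulr0.
by rewrite mul0r.
Qed.

Lemma dot_ebasis_u m : dot (ebasis R m) u = (useq R m)%:C.
Proof.
rewrite dotC dot_ebasis entry_uvec; exact: conjCR.
Qed.

(* A(0) for the three families. For c = 1 it is a non-selfadjoint block triangular
   operator with the same eigenvalues as for c = 0. *)
Definition limit_op c x : H := lamdiag x - c *: (dot x u *: e0).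

Lemma entry_limit_op c x n :
  entry (limit_op c x) n = (lam n)%:C * entry x n - c * (dot x u * (n == 0%N)%:R).
Proof. by rewrite !entryE entry_lamdiag entry_e0. Qed.

Lemma bop_limit_op c : bounded_operator (limit_op c).
Proof.
apply: bop_sub; first exact: bop_diag norm_lam_le.
by apply: bop_scale; exact: bop_rank1.
Qed.

Lemma kernel_limit_op c :
  Defs.kernel (limit_op c) = [set x | forall n, n != 0%N -> entry x n = 0].
Proof.
apply/seteqP; split => x /= x0.
  move=> n n0; have := congr1 (fun w : H => entry w n) x0.
  rewrite entry_limit_op entry0 (negPf n0) !mulr0 subr0 => /eqP.
  rewrite mulf_eq0 => /orP[/eqP/complexI ln|/eqP//].
  by have := @lam_gt0 R n; rewrite lt0n n0 ln ltxx => /(_ isT).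
apply: ell2P => n; rewrite entry_limit_op (dot_u_tail0 x0) mul0r mulr0 subr0 entry0.
have [->|n0] := eqVneq n 0%N; last by rewrite x0// mulr0.
by rewrite lam0 mul0r.
Qed.

(** Only row 0 of [limit_op] couples different entries, so powers are explicit in all other rows;
    row 0 becomes explicit once these entries vanish. *)
Lemma entry_iter_limit_op c (l : C) x k n : n != 0%N ->
  entry (iter k (fun y => limit_op c y - l *: y) x) n =
  ((lam n)%:C - l) ^+ k * entry x n.
Proof.
move=> n0; elim: k => [|k IH]; first by rewrite mul1r.
rewrite iterS entryB entryZ entry_limit_op IH (negPf n0) exprS /=; ring.
Qed.

Lemma entry0_iter_limit_op c (l : C) x k :
  (forall n, n != 0%N -> entry x n = 0) ->
  entry (iter k (fun y => limit_op c y - l *: y) x) 0 = (- l) ^+ k * entry x 0.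
Proof.
move=> x0; elim: k => [|k IH]; first by rewrite mul1r.
rewrite iterS entryB entryZ entry_limit_op IH dot_u_tail0 ?exprS; last first.
  by move=> n n0; rewrite entry_iter_limit_op// x0// mulr0.
rewrite lam0 /=; ring.
Qed.

Lemma generalized_entry c (l : R) x n : n != 0%N -> l <> lam n ->
  generalized_eigenspace (limit_op c) l%:C x -> entry x n = 0.
Proof.
move=> n0 ln [k /(congr1 (fun w : H => entry w n))].
rewrite entry_iter_limit_op// entry0 => /eqP; rewrite mulf_eq0 => /orP[|/eqP//].
rewrite expf_eq0 subr_eq0 => /andP[_ /eqP/complexI e].
by case: ln.
Qed.

Lemma limit_op_mult0 c (l : R) : 0 < l ->
  (forall n, (0 < n)%N -> l <> lam n) ->
  algebraic_multiplicity (limit_op c) l%:C = 0%E.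
Proof.
move=> l0 ln; apply: dimension0 => x xl.
have x0 n : n != 0%N -> entry x n = 0.
  by move=> n0; apply: (generalized_entry n0 _ xl); apply: ln; rewrite lt0n.
apply: ell2P => n; rewrite entry0; have [->|] := eqVneq n 0%N; last exact: x0.
have [k /(congr1 (fun w : H => entry w 0))] := xl.
rewrite entry0_iter_limit_op// entry0 => /eqP; rewrite mulf_eq0 => /orP[|/eqP//].
rewrite expf_eq0 oppr_eq0 => /andP[_ /eqP/complexI l00].
by rewrite l00 ltxx in l0.
Qed.

Lemma limit_op_mult c m : (0 < m)%N ->
  (1 <= algebraic_multiplicity (limit_op c) (lam m)%:C < +oo)%E.
Proof.
move=> m0; have lm := lam_gt0 R m0.
have lmC : (lam m)%:C != 0 :> C.
  by apply/negP => /eqP/complexI h; rewrite h ltxx in lm.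
apply/andP; split.
  (* The eigenvector is e_m corrected along e_0; row 0 of the eigenvalue equation reads - c u_m =
     lam m a. *)
  pose a : C := - c * (useq R m)%:C / (lam m)%:C.
  pose x : H := a *: e0 + (ebasis R m : H).
  have mN0 : (m == 0%N) = false by lia.
  apply: (@dimension_ge1 _ _ x).
    exists 1%N => /=; apply: ell2P => n.
    have ux : dot x u = (useq R m)%:C.
      apply: (eq_trans (dot_linearl u a e0 (ebasis R m))).
      by rewrite !dot_ebasis_u {1}/useq /= mulr0 mulr0 add0r.
    rewrite entryB entryZ entry_limit_op ux !entryE !entry_ebasis.
    have [->|n0] := eqVneq n 0%N.
      rewrite eq_sym mN0 lam0 /= !(mulr1, mulr0, addr0) rmorph0 mul0r sub0r.
      by rewrite /a [(lam m)%:C * _]mulrC divfK// mulNr subrr.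
    by have [->|nm] := eqVneq n m; 
      rewrite /= !(mulr1, mulr0, oppr0, addr0, add0r) ?subr0 ?subrr.
  apply/negP => /eqP/(congr1 (fun w : H => entry w m)).
  rewrite !entryE !entry_ebasis eqxx mN0 mulr0 add0r => /eqP.
  by rewrite oner_eq0.
(* A crude bound by m + 1 is enough for finiteness: a generalized eigenvector has no entries beyond
   m. *)
pose W : set H := [set x | forall n, (m < n)%N -> entry x n = 0].
apply: (@le_lt_trans _ _ (dimension W)).
  apply: le_ereal_sup => _ [n [w [wV wf]] <-]; exists n => //; exists w; split => //.
  move=> i k mk; apply: generalized_entry (wV i); first by lia.
  have := @lam_decr R m k; rewrite m0 mk => /(_ isT) h h'.
  by rewrite -h' in h; lra.
apply: le_lt_trans (ltry m.+1%:R); apply: dimension_le => [n a w wW k mk|x xW x0].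
  by rewrite entry_sum big1// => i _; rewrite entryZ wW// mulr0.
apply: ell2P => k; rewrite entry0; have [km|mk] := ltnP k m.+1; first exact: x0.
exact: xW.
Qed.

Lemma lam_tail z : z != 0 -> exists2 N, (0 < N)%N &
  forall n, (N <= n)%N -> `|(lam n)%:C / z| <= (1 / 2)%:C.
Proof.
move=> z0; have [r r0 zr] := normC_real z.
have {}r0 : 0 < r by rewrite -ltcR -zr normr_gt0.
pose N := (Num.truncn (2 / r)).+1.
have rN : 2 / r < N%:R by exact: truncnS_gt.
exists N => // n Nn; rewrite normrM normfV zr normCR ler_pdivrMr ?ltcR//.
rewrite -rmorphM lecR ger0_norm ?lam_ge0//.
have n0 : (0 < n)%N by exact: leq_trans Nn.
apply: le_trans (lam_le R n0) _; rewrite -[leLHS]mul1r ler_pdivrMr ?ltr0n//.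
move: rN; rewrite ltr_pdivrMr// => rN.
have : (N%:R : R) <= n%:R by rewrite ler_nat.
move=> /(ler_wpM2r (ltW r0)); lra.
Qed.

Lemma one_add_small (t : C) : `|t| <= (1 / 2 : R)%:C ->
  1 + t != 0 /\ `|(1 + t)^-1| <= 2%:C.
Proof.
move=> t2; have h : (1 / 2 : R)%:C <= `|1 + t|.
  have := lerB_dist 1 (- t); rewrite opprK normrN normr1; apply: le_trans.
  have -> : (1 / 2 : R)%:C = 1 - (1 / 2)%:C by rewrite -(rmorph1 (real_complex R)) -rmorphB;
    congr (_%:C); lra.
  by rewrite lerD2l lerN2.
have h0 : 0 < `|1 + t| by apply: lt_le_trans h; rewrite ltcR divr_gt0.
split; first by rewrite -normr_gt0.
rewrite normfV -[leLHS]mul1r ler_pdivrMr//.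
apply: le_trans (ler_wpM2l _ h); rewrite ?ler0c//.
by rewrite -rmorphM -(rmorph1 (real_complex R)) lecR; lra.
Qed.

Definition op_family (A0 A1 A2 : H -> H) z x : H :=
  A0 x + z *: A1 x + z ^+ 2 *: A2 x.

Lemma op_family0 A0 A1 A2 : op_family A0 A1 A2 0 = A0.
Proof.
by apply/funext => x; rewrite /op_family expr0n /= !scale0r !addr0.
Qed.

Lemma entry_Fop (A : C -> H -> H) z x n :
  entry (Fop A z x) n = entry x n - z^-1 * entry (A z x) n.
Proof. by rewrite /Fop entryB entryZ. Qed.

Section Bounded.
Variables A0 A1 A2 : H -> H.
Hypotheses (b0 : bounded_operator A0) (b1 : bounded_operator A1)
  (b2 : bounded_operator A2).

Lemma bop_family z : bounded_operator (op_family A0 A1 A2 z).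
Proof. by apply: bop_add; [apply: bop_add => //|]; apply: bop_scale. Qed.

Lemma bop_Fop_family z : bounded_operator (Fop (op_family A0 A1 A2) z).
Proof. exact: bop_sub (@bop_id R) (bop_scale _ (bop_family z)). Qed.

Lemma family_derivative0 : op_derivative (op_family A0 A1 A2) 0 = A1.
Proof.
rewrite (op_derivative_unique (quadratic_derivative A0 0 b1 b2)).
by apply/funext => x; rewrite mulr0 scale0r addr0.
Qed.

Lemma family_fredholm :
  (forall z, z != 0 -> fredholm (Fop (op_family A0 A1 A2) z)) ->
  invertible (Fop (op_family A0 A1 A2) 1) ->
  fredholm_family setT (op_family A0 A1 A2).
Proof.
move=> Ff F1; split => //.
- split; [exact: openT| |by exists 0].
  by apply: (@star_connected _ _ 0).
- move=> z _; split; first exact: bop_family.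
  by eexists; exact: quadratic_derivative.
- by move=> z _; exact: Ff.
- by exists 1; split => //; exact: oner_neq0.
Qed.

Lemma hyp_invertible_family c : A0 = limit_op c ->
  hyp_invertible (op_family A0 A1 A2) <->
  invertible (fun x => x - A1 (entry x 0 *: e0)).
Proof.
move=> A0E; rewrite /hyp_invertible family_derivative0 op_family0 A0E kernel_limit_op.
by under eq_fun do rewrite orth_proj_ebasis.
Qed.

End Bounded.

End Families.

(** * Fredholm property and invertibility of the three families *)

Section Examples.
Variable R : realType.
Local Notation C := R[i].
Local Notation H := (ell2_hilbert R).
Local Notation lam := (@lam R).
Local Notation u := (uvec R).
Local Notation v := (vvec R).
Local Notation e0 := (ebasis R 0 : H).
Implicit Types (z c : C) (x y w : H) (n m k : nat).

Lemma bop0 : bounded_operator (fun=> 0 : H).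
Proof.
split; first by move=> a x y; rewrite scaler0 addr0.
by exists 0 => x; rewrite normr0 mul0r.
Qed.

Definition shift_family : C -> H -> H :=
  op_family (limit_op 0) (fun x => 2 *: x) (fun=> 0).

Definition nilpotent_family : C -> H -> H :=
  op_family (limit_op 1) (fun x => -1 *: (dot x e0 *: v)) (fun=> 0).

Definition kernel_family : C -> H -> H :=
  op_family (limit_op 0)
    (fun x => dot x e0 *: e0 - dot x u *: e0 - dot x e0 *: v)
    (fun x => -1 *: (dot x e0 *: e0)).

Lemma bop_shift1 : bounded_operator (fun x : H => 2 *: x : H).
Proof. exact: bop_scale (@bop_id R). Qed.

Lemma bop_nilpotent1 : bounded_operator (fun x : H => -1 *: (dot x e0 *: v) : H).
Proof. by apply: bop_scale; exact: bop_rank1. Qed.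

Lemma bop_kernel1 : bounded_operator
  (fun x : H => dot x e0 *: e0 - dot x u *: e0 - dot x e0 *: v : H).
Proof. by apply: bop_sub; [apply: bop_sub|]; exact: bop_rank1. Qed.

Lemma bop_kernel2 : bounded_operator (fun x : H => -1 *: (dot x e0 *: e0) : H).
Proof. by apply: bop_scale; exact: bop_rank1. Qed.

Lemma entry_shift z x n : z != 0 ->
  entry (Fop shift_family z x) n = - (1 + (lam n)%:C / z) * entry x n.
Proof.
move=> z0; rewrite entry_Fop /shift_family /op_family !entryE entry_lamdiag entry_e0.
move: (lam n)%:C => l; field; exact: z0.
Qed.

Lemma entry_nilpotent z x n : n != 0%N -> z != 0 ->
  entry (Fop nilpotent_family z x) n =
  (1 - (lam n)%:C / z) * entry x n + (vseq R n)%:C * entry x 0.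
Proof.
move=> n0 z0; rewrite entry_Fop /nilpotent_family /op_family !entryE.
rewrite entry_lamdiag entry_e0 entry_vvec dot_e0 (negPf n0) /=.
move: (lam n)%:C (vseq R n)%:C => l t; field; exact: z0.
Qed.

Lemma entry0_nilpotent z x : z != 0 ->
  entry (Fop nilpotent_family z x) 0 = entry x 0 + dot x u / z.
Proof.
move=> z0; rewrite entry_Fop /nilpotent_family /op_family !entryE.
rewrite entry_lamdiag entry_e0 entry_vvec dot_e0 lam0 /=.
have -> : (vseq R 0)%:C = 0 :> C by [].
rewrite ?rmorph0; field; exact: z0.
Qed.

Lemma entry_kernel z x n : n != 0%N -> z != 0 ->
  entry (Fop kernel_family z x) n = entry (Fop nilpotent_family z x) n.
Proof.
move=> n0 z0; rewrite entry_nilpotent// entry_Fop /kernel_family /op_family !entryE.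
rewrite entry_lamdiag entry_e0.
rewrite entry_vvec dot_e0 (negPf n0) /=.
move: (lam n)%:C (vseq R n)%:C => l t; field; exact: z0.
Qed.

Lemma entry0_kernel z x : z != 0 ->
  entry (Fop kernel_family z x) 0 = z * entry (Fop nilpotent_family z x) 0.
Proof.
move=> z0; rewrite entry0_nilpotent// entry_Fop /kernel_family /op_family !entryE.
rewrite entry_lamdiag entry_e0.
rewrite entry_vvec dot_e0 lam0 /=.
have -> : (vseq R 0)%:C = 0 :> C by [].
rewrite ?rmorph0; field; exact: z0.
Qed.

Lemma shift_fredholm z : z != 0 -> fredholm (Fop shift_family z).
Proof.
move=> z0; have [N N0 tail] := lam_tail z0.
apply: (@fredholm_of_tail _ N (fun n => - (1 + (lam n)%:C / z)) 2).
- exact: bop_Fop_family (bop_limit_op 0) bop_shift1 bop0 z.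
- by move=> n /tail/one_add_small[h1 h2]; rewrite oppr_eq0 invrN normrN.
- by move=> x _ n _; rewrite entry_shift.
Qed.

Lemma nilpotent_fredholm z : z != 0 -> fredholm (Fop nilpotent_family z).
Proof.
move=> z0; have [N N0 tail] := lam_tail z0.
apply: (@fredholm_of_tail _ N (fun n => 1 - (lam n)%:C / z) 2).
- exact: bop_Fop_family (bop_limit_op 1) bop_nilpotent1 bop0 z.
- by move=> n /tail; rewrite -normrN => /one_add_small.
- have nN0 n : (N <= n)%N -> n != 0%N by rewrite -lt0n; exact: leq_trans.
  move=> x x0 n Nn; rewrite entry_nilpotent ?nN0//.
  by rewrite (x0 0%N N0) mulr0 addr0.
Qed.

Lemma kernel_fredholm z : z != 0 -> fredholm (Fop kernel_family z).
Proof.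
move=> z0; have [N N0 tail] := lam_tail z0.
apply: (@fredholm_of_tail _ N (fun n => 1 - (lam n)%:C / z) 2).
- exact: bop_Fop_family (bop_limit_op 0) bop_kernel1 bop_kernel2 z.
- by move=> n /tail; rewrite -normrN => /one_add_small.
- have nN0 n : (N <= n)%N -> n != 0%N by rewrite -lt0n; exact: leq_trans.
  move=> x x0 n Nn; rewrite entry_kernel ?nN0// entry_nilpotent ?nN0//.
  by rewrite (x0 0%N N0) mulr0 addr0.
Qed.

Lemma Re_gt0_neq0 z : 0 < complex.Re z -> z != 0.
Proof. by apply: contraTneq => ->; rewrite /= ltxx. Qed.

(** Since Re (1 / z) > 0, each diagonal entry 1 + lam n / z has real part at least 1, and the
    inverse is diagonal with entries bounded by 1. *)
Lemma shift_invertible z : 0 < complex.Re z -> invertible (Fop shift_family z).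
Proof.
move=> zp; have z0 := Re_gt0_neq0 zp.
have h n : 1 <= `|1 + (lam n)%:C / z|.
  apply: le_trans (normc_ge_Re _); rewrite -(rmorph1 (real_complex R)) lecR.
  apply: le_trans (ler_norm _); rewrite ReD /= lerDl.
  case: z zp {z0} => a b /= a0; rewrite mul0r subr0.
  by rewrite mulr_ge0 ?lam_ge0// divr_ge0 ?(ltW a0)// addr_ge0 ?sqr_ge0.
have h0 n : 1 + (lam n)%:C / z != 0.
  by rewrite -normr_gt0; apply: lt_le_trans (h n).
pose g n := - (1 + (lam n)%:C / z)^-1.
have g1 n : `|g n| <= 1%:C.
  by rewrite normrN normfV invf_le1 ?normr_gt0//; exact: h.
exists (diag g); split; first exact: bop_diag g1.
  move=> x; apply: ell2P => n; rewrite (entry_diag g1) entry_shift// mulrA mulrNN.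
  by rewrite mulVf// mul1r.
move=> x; apply: ell2P => n; rewrite entry_shift// (entry_diag g1) mulrA mulrNN.
by rewrite mulfV// mul1r.
Qed.

Lemma nilpotent_invertible z : 0 < complex.Re z -> invertible (Fop nilpotent_family z).
Proof.
move=> zp; have z0 := Re_gt0_neq0 zp.
have [r r0 zr] := normC_real z.
have {}r0 : 0 < r by rewrite -ltcR -zr normr_gt0.
have ex : exists m, (0 < m)%N && (lam m <= 8 * r).
  exists (Num.truncn r^-1).+1; rewrite ltn0Sn andTb.
  apply: le_trans (lam_le R (ltn0Sn _)) _.
  rewrite -[leLHS]mul1r ler_pdivrMr ?ltr0n//.
  have : r^-1 < (Num.truncn r^-1).+1%:R by exact: truncnS_gt.
  rewrite -[ltLHS]mul1r ltr_pdivrMr//; lra.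
(* The least such m is the index of the largest eigenvalue in the window, as the estimates above
   require. *)
have [m /andP[m0 mr] mmin] := ex_minnP ex.
have m_min k : (0 < k < m)%N -> 8 * r < lam k.
  move=> /andP[k0 km]; rewrite ltNge; apply/negP => kr.
  by have := mmin k; rewrite k0 kr => /(_ isT); rewrite leqNgt km.
have mN0 : m != 0%N by rewrite -lt0n.
have g2 := gres_le zp zr m0 mr m_min.
have det0 := window_det_neq0 zp zr m0 mr m_min.
set g := gres z m in g2.
have gE n : n != 0%N -> n != m -> g n * (1 - (lam n)%:C / z) = 1.
  move=> n0 nm; rewrite /g /gres (negPf n0) (negPf nm) /=.
  have := gres_neq0 zp zr m0 mr m_min n0 nm.
  by move: (lam n)%:C => l zl; field; rewrite z0 zl.
have g00 : g 0%N = 0 by [].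
have gm0 : g m = 0 by rewrite /g /gres eqxx orbT.
pose a11 := schur z m; pose um : C := (useq R m)%:C; pose vm : C := (vseq R m)%:C.
pose dm : C := 1 - (lam m)%:C / z.
have detE : window_det z m = a11 * dm - um * vm / z by rewrite /window_det rmorphM.
set det := window_det z m in det0 detE.
(* For the right-hand side x, [q x] is what row 0 becomes after elimination. [X] and [Y] are
   Cramer's solution of the 2x2 system for the entries 0 and m, and [S] adds the other entries by
   back substitution; g vanishes at 0 and m, so the pieces do not overlap. *)
pose q x := entry x 0 - dot (diag g x) u / z.
pose X x := (dm * q x - um / z * entry x m) / det.
pose Y x := (a11 * entry x m - vm * q x) / det.
pose em : H := ebasis R m.
pose S x : H := diag g (x - X x *: v) + X x *: e0 + Y x *: em.
have bg : bounded_operator (diag g) by exact: bop_diag g2.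
have bq (b : H) : bounded_operator (fun x : H => q x *: b : H).
  have := bop_sub (bop_rank1 e0 b) (bop_scale z^-1 (bop_comp (bop_rank1 u b) bg)).
  congr bounded_operator; apply/funext => x.
  by rewrite dot_e0 scalerA -scalerBl /q [z^-1 * _]mulrC.
have bX (b : H) : bounded_operator (fun x : H => X x *: b : H).
  have := bop_scale det^-1 (bop_sub (bop_scale dm (bq b))
    (bop_scale (um / z) (bop_rank1 em b))).
  congr bounded_operator; apply/funext => x.
  by rewrite dot_ebasis !scalerA -scalerBl scalerA /X mulrC.
have bY (b : H) : bounded_operator (fun x : H => Y x *: b : H).
  have := bop_scale det^-1 (bop_sub (bop_scale a11 (bop_rank1 em b))
    (bop_scale vm (bq b))).
  congr bounded_operator; apply/funext => x.
  by rewrite dot_ebasis !scalerA -scalerBl scalerA /Y mulrC.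
have bS : bounded_operator S.
  exact: bop_add (bop_add (bop_comp bg (bop_sub (@bop_id R) (bX v))) (bX e0)) (bY em).
have dot_lin (a b : C) (x y w : H) :
    dot (x + a *: y + b *: w) u = dot x u + a * dot y u + b * dot w u.
  have D (c : C) (s t : H) : dot (s + c *: t) u = dot s u + c * dot t u.
    by rewrite addrC (dot_linearl u c t s) addrC.
  by rewrite !D.
have u0 : dot e0 u = 0 by rewrite dot_ebasis_u /useq /= mulr0.
have uem : dot em u = um by rewrite dot_ebasis_u.
have schurE : dot (diag g v) u = (1 - a11) * z by rewrite /a11 /schur -/g; field.
have emE n : entry em n = (n == m)%:R by exact: entry_ebasis.
have mN0' : (0%N == m) = false by rewrite eq_sym (negPf mN0).
have SE0 x : entry (S x) 0 = X x.
  rewrite !entryE (entry_diag g2) g00 entry_e0 emE mN0' /=; ring.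
have SEm x : entry (S x) m = Y x.
  by rewrite !entryE (entry_diag g2) gm0 entry_e0 emE eqxx (negPf mN0) /=; ring.
have SE x n : n != 0%N -> n != m ->
    entry (S x) n = g n * (entry x n - X x * (vseq R n)%:C).
  move=> n0 nm; rewrite !entryE (entry_diag g2) !entryE entry_vvec entry_e0 emE.
  by rewrite (negPf n0) (negPf nm) /=; ring.
have Su x : dot (S x) u = dot (diag g x) u - X x * dot (diag g v) u + Y x * um.
  rewrite /S dot_lin u0 uem; congr (_ + _); rewrite mulr0 addr0.
  rewrite (linearB_op _ _ bg.1).
  have -> : diag g (X x *: v) = X x *: diag g v.
    by have := bg.1 (X x) v 0; rewrite (linear0_op bg.1) !addr0.
  by have := dot_lin (- X x) 0 (diag g x) (diag g v) 0;
    rewrite scale0r addr0 mul0r addr0 scaleNr mulNr.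
exists S; split => // x; apply: ell2P => n.
- have F0 := entry0_nilpotent x z0; have Fn k hk := @entry_nilpotent z x k hk z0.
  move: (Fop nilpotent_family z x) F0 Fn => y y0 yn.
  (* Applied to y = F(z) x, g recovers x outside rows 0 and m, up to the term created by the
     coupling with v. *)
  have gF : diag g y =
      (x + (- entry x 0) *: e0 + (- entry x m) *: em) + entry x 0 *: diag g v.
    apply: ell2P => k; rewrite (entry_diag g2) entryD entryD entryD !entryZ.
    rewrite (entry_diag g2) entry_e0 emE entry_vvec.
    have [->|k0] := eqVneq k 0%N; first by rewrite g00 mN0' /=; ring.
    have [->|km] := eqVneq k m; first by rewrite gm0 /=; ring.
    by rewrite yn// [LHS]mulrDr [X in X + _ = _]mulrA gE//=; ring.
  have qF : q y = a11 * entry x 0 + um / z * entry x m.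
    rewrite /q y0 gF.
    have := dot_lin (entry x 0) 0
      (x + (- entry x 0) *: e0 + (- entry x m) *: em) (diag g v) 0.
    rewrite scale0r addr0 mul0r addr0 => ->; rewrite dot_lin u0 uem schurE.
    by field.
  have XF : X y = entry x 0.
    by rewrite /X qF yn// -/dm -/vm; apply: (mulIf det0); rewrite divfK// detE; ring.
  have YF : Y y = entry x m.
    by rewrite /Y qF yn// -/dm -/vm; apply: (mulIf det0); rewrite divfK// detE; ring.
  have [->|n0] := eqVneq n 0%N; first by rewrite SE0.
  have [->|nm] := eqVneq n m; first by rewrite SEm.
  rewrite SE// XF yn// [entry x 0 * _]mulrC addrK mulrA gE//.
  by rewrite mul1r.
- have [->|n0] := eqVneq n 0%N.
    rewrite entry0_nilpotent// Su SE0 schurE.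
    have -> : dot (diag g x) u = (entry x 0 - q x) * z by rewrite /q; field.
    have e : a11 * X x + um / z * Y x = q x.
      rewrite /X /Y; apply: (mulIf det0); rewrite mulrDl !mulrA !divfK// detE; ring.
    by rewrite -e; field.
  rewrite entry_nilpotent// SE0.
  have [->|nm] := eqVneq n m.
    rewrite SEm -/dm -/vm /X /Y; apply: (mulIf det0).
    by rewrite mulrDl !mulrA !divfK// detE; ring.
  by rewrite SE// mulrA [_ * g n]mulrC gE// mul1r mulrC subrK.
Qed.

End Examples.

(** * Which hypotheses hold for which family *)

Section Hypotheses.
Variable R : realType.
Local Notation C := R[i].
Local Notation H := (ell2_hilbert R).
Local Notation lam := (@lam R).
Local Notation u := (uvec R).
Local Notation v := (vvec R).
Local Notation e0 := (ebasis R 0 : H).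
Implicit Types (z c : C) (x y w : H) (n m : nat).

(** Here F(z) is diag(z, 1, 1, ...) composed with the operator of [nilpotent_family], and z is
    nonzero. *)
Lemma kernel_invertible z : 0 < complex.Re z -> invertible (Fop (@kernel_family R) z).
Proof.
move=> zp; have z0 := Re_gt0_neq0 zp.
have [S [bS FS SF]] := nilpotent_invertible zp.
pose d n : C := if n == 0%N then z^-1 else 1.
have [r r0 zr] := normC_real z^-1.
have dr n : `|d n| <= (r + 1)%:C.
  rewrite /d; case: eqP => _; first by rewrite zr lecR lerDl.
  by rewrite normr1 -(rmorph1 (real_complex R)) lecR lerDr.
have dF x : diag d (Fop (@kernel_family R) z x) = Fop (@nilpotent_family R) z x.
  apply: ell2P => n; rewrite (entry_diag dr) /d.
  have [->|n0] := eqVneq n 0%N; first by rewrite entry0_kernel// mulKf.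
  by rewrite mul1r entry_kernel.
exists (fun x => S (diag d x)); split.
- by apply: bop_comp => //; exact: bop_diag dr.
- by move=> x; rewrite dF FS.
- move=> x; apply: ell2P => n; have [->|n0] := eqVneq n 0%N.
    by rewrite entry0_kernel// SF (entry_diag dr) /d eqxx mulVKf.
  by rewrite entry_kernel// SF (entry_diag dr) /d (negPf n0) mul1r.
Qed.

Lemma vseq_le n : 0 <= vseq R n <= 1.
Proof.
rewrite vseq_ge0; case: n => [|n]; first exact: ler01.
by rewrite vseqE// invf_le1 ?exprn_gt0// exprn_ege1// ler1n.
Qed.

Lemma lam_le_vseq n : lam n <= vseq R n.
Proof.
have /andP[v0 v1] := vseq_le n; rewrite -sqr_vseq expr2.
by rewrite -[leRHS]mulr1 ler_wpM2l.
Qed.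

(** The unit ball is sent into the cube of M e_0 + N v. The weights v_n majorize both the diagonal
    part, as lam n = v_n^2 <= v_n, and the multiples of v. *)
Lemma compact_weighted (T : H -> H) (M N : R) : 0 <= M -> 0 <= N ->
  (forall x, `|x| <= 1 -> `|entry (T x) 0| <= M%:C) ->
  (forall x n, n != 0%N -> `|x| <= 1 -> `|entry (T x) n| <= N%:C * (vseq R n)%:C) ->
  compact_operator T.
Proof.
move=> M0 N0 TM TN.
apply: (@compact_of_cube _ _ ((M%:C *: e0 + N%:C *: v : H) : ell2 R)) => x x1 n.
rewrite !entryE entry_e0 entry_vvec; have [->|n0] := eqVneq n 0%N.
  have -> : (vseq R 0)%:C = 0 :> C by [].
  by rewrite mulr1 mulr0 addr0 normCR (ger0_norm M0); exact: TM.
rewrite mulr0 add0r -rmorphM normCR (ger0_norm (mulr_ge0 N0 (vseq_ge0 R n))).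
by rewrite rmorphM; exact: TN.
Qed.

Lemma entry_le1 x n : `|x| <= 1 -> `|entry x n| <= 1.
Proof. by apply: le_trans; exact: entry_le. Qed.

Lemma lam_entry_le x n : `|x| <= 1 ->
  `|(lam n)%:C * entry x n| <= (vseq R n)%:C.
Proof.
move=> x1; rewrite normrM normCR (ger0_norm (lam_ge0 R n)) -[leRHS]mulr1.
apply: ler_pM => //; [by rewrite ler0c lam_ge0|by rewrite lecR lam_le_vseq|exact: entry_le1].
Qed.

Lemma v_entry_le x n : `|x| <= 1 ->
  `|entry x 0 * (vseq R n)%:C| <= (vseq R n)%:C.
Proof.
move=> x1; have /andP[v0 _] := vseq_le n.
by rewrite normrM normCR (ger0_norm v0) ler_piMl ?ler0c// entry_le1.
Qed.

Lemma dot_u_le x : `|x| <= 1 -> `|dot x u| <= `|u|.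
Proof. by move=> x1; rewrite (le_trans (dot_norm_le _ _))// ler_piMl. Qed.

Lemma nilpotent_compact : hyp_compact setT (@nilpotent_family R).
Proof.
move=> z _; have [r r0 zr] := normC_real z.
have [s s0 us] := ge0C_real (normr_ge0 (u : ell2 R)).
apply: (@compact_weighted _ s (1 + r)) => // [|x x1|x n n0 x1]; first exact: addr_ge0.
  rewrite /nilpotent_family /op_family !entryE entry_lamdiag entry_e0 entry_vvec.
  have -> : (vseq R 0)%:C = 0 :> C by [].
  rewrite ?lam0 -us; apply: le_trans (dot_u_le x1).
  by rewrite /= !(mul0r, mulr0, mul1r, mulr1, addr0, add0r) normrN.
rewrite /nilpotent_family /op_family !entryE entry_lamdiag entry_e0 entry_vvec.
rewrite dot_e0 (negPf n0) /= !(mulr0, subr0, addr0) rmorphD mulrDl mul1r.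
apply: le_trans (ler_normD _ _) (lerD (lam_entry_le n x1) _).
by rewrite normrM zr ler_wpM2l ?ler0c// mulN1r normrN v_entry_le.
Qed.

Lemma kernel_compact : hyp_compact setT (@kernel_family R).
Proof.
move=> z _; have [r r0 zr] := normC_real z.
have [s s0 us] := ge0C_real (normr_ge0 (u : ell2 R)).
apply: (@compact_weighted _ (r * (1 + s) + r ^+ 2) (1 + r)) => [| |x x1|x n n0 x1].
- by rewrite addr_ge0 ?exprn_ge0// mulr_ge0// addr_ge0.
- exact: addr_ge0.
- rewrite /kernel_family /op_family !entryE entry_lamdiag entry_e0 entry_vvec.
  have -> : (vseq R 0)%:C = 0 :> C by [].
  rewrite ?lam0 dot_e0 /= !(mul0r, mulr0, mulr1, oppr0, subr0, add0r).
  rewrite rmorphD rmorphM rmorphD rmorphXn rmorph1 /=.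
  apply: le_trans (ler_normD _ _) (lerD _ _).
    rewrite normrM zr ler_wpM2l ?ler0c// (le_trans (ler_normB _ _))// lerD//.
      exact: entry_le1.
    by rewrite -us dot_u_le.
  rewrite normrM normrX zr mulN1r normrN -[leRHS]mulr1 ler_wpM2l ?exprn_ge0 ?ler0c//.
  exact: entry_le1.
rewrite /kernel_family /op_family !entryE entry_lamdiag entry_e0 entry_vvec.
rewrite dot_e0 (negPf n0) /= !(mulr0, mul0r, oppr0, subr0, add0r, addr0) rmorphD mulrDl mul1r.
apply: le_trans (ler_normD _ _) (lerD (lam_entry_le n x1) _).
by rewrite normrM zr ler_wpM2l ?ler0c// normrN v_entry_le.
Qed.

Lemma shift_not_compact : ~ hyp_compact setT (@shift_family R).
Proof.
move=> /(_ 1 Logic.I) [K TK [cK _]].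
pose T : H -> H := shift_family 1.
have TE x n : entry (T x) n = ((lam n)%:C + 2) * entry x n.
  by rewrite /T /shift_family /op_family !entryE entry_lamdiag entry_e0; ring.
pose s n : H := T (ebasis R n).
(* The images of the basis vectors at z = 1 are at mutual distance at least 2, while a cluster point
   would bring two of them closer than 2. *)
have sK n : K (s n).
  apply: TK; exists (ebasis R n : H) => //=; apply: ell2_norm_le => // m.
  rewrite expr1n; apply: (@le_trans _ _ (dot (ebasis R n) (ebasis R n))).
    exact: dotxx_ge.
  by rewrite dot_ebasis entry_ebasis eqxx.
have [|p [Kp clp]] := cK (s @ \oo) _; first by exists 0%N => // n _; exact: sK.
have near_p N : exists2 n, (N <= n)%N & `|p - s n| < 1.
  have nb : nbhs p (ball p (1 : C)) by exact: nbhsx_ballx.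
  have sN : (s @ \oo) [set s n | n in [set n | (N <= n)%N]].
    by exists N => // n Nn; exists n.
  have [_ [[n Nn <-]]] := clp _ _ sN nb.
  by rewrite -ball_normE; exists n.
have [n1 _ h1] := near_p 0%N; have [n2 n12 h2] := near_p n1.+1.
have h : `|s n1 - s n2| < 2.
  rewrite -(subrK p (s n1)) -addrA (le_lt_trans (ler_normD _ _))//.
  rewrite (distrC (s n1)); have -> : 2 = 1 + 1 :> C by ring.
  exact: ltrD h1 h2.
have := le_lt_trans (entry_le (s n1 - s n2) n1) h.
rewrite entryB !TE !entry_ebasis eqxx ltn_eqF// mulr0 subr0 mulr1.
have -> : 2 = (2 : R)%:C :> C by rewrite rmorph_nat.
rewrite -raddfD normCR ltcR (ger0_norm (addr_ge0 (lam_ge0 R n1) (ler0n R 2))).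
by rewrite ltNge lerDr lam_ge0.
Qed.

Lemma limit_op0_selfadjoint : selfadjoint (limit_op (0 : C)).
Proof.
move=> x y; rewrite /hdot /= /dot; congr csum; apply/funext => n.
rewrite !entry_limit_op !mul0r !subr0 rmorphM /= conjCR.
by rewrite mulrCA mulrA.
Qed.

Lemma limit_op1_not_selfadjoint : ~ selfadjoint (limit_op (1 : C)).
Proof.
move=> /(_ (ebasis R 1%N) (ebasis R 0)).
rewrite /hdot /= dot_ebasis dotC dot_ebasis.
have -> : entry (limit_op 1 (ebasis R 1%N)) 0 = - (useq R 1%N)%:C.
  by rewrite entry_limit_op dot_ebasis_u entry_ebasis /= mulr0 sub0r mul1r mulr1.
have -> : entry (limit_op 1 (ebasis R 0)) 1 = 0.
  by rewrite entry_limit_op entry_ebasis /= !mulr0 subr0.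
rewrite conjC0 => /eqP; rewrite oppr_eq0 => /eqP/complexI/eqP.
by rewrite /useq vseqE// !mulf_eq0 invr_eq0 !expf_eq0 oppr_eq0 oner_eq0 !pnatr_eq0.
Qed.

(** The coefficient 2 of z makes I - A'(0) Pi_0 the reflection that changes the sign of the entry 0,
    an involution. *)
Lemma shift_hyp_invertible : hyp_invertible (@shift_family R).
Proof.
apply/(hyp_invertible_family (@bop_shift1 R) (@bop0 R) (erefl (limit_op 0))).
pose T x : H := x - 2 *: (entry x 0 *: e0).
have TE x n : entry (T x) n = if n == 0%N then - entry x 0 else entry x n.
  rewrite !entryE entry_e0; case: eqP => [->|_] /=; ring.
have TT : cancel T T.
  by move=> x; apply: ell2P => n; rewrite !TE; case: eqP => // ->; rewrite opprK.
exists T; split => //; apply: bop_sub (@bop_id R) _.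
have := bop_scale 2 (bop_rank1 e0 e0); congr bounded_operator.
by apply/funext => x; rewrite dot_e0.
Qed.

(** The operator is x + x_0 v; as v_0 = 0, the perturbation squares to zero and the inverse is x -
    x_0 v. *)
Lemma nilpotent_hyp_invertible : hyp_invertible (@nilpotent_family R).
Proof.
apply/(hyp_invertible_family (@bop_nilpotent1 R) (@bop0 R) (erefl (limit_op 1))).
have e (a : C) : dot (a *: e0) e0 = a.
  by rewrite dot_e0 entryZ entry_e0 mulr1.
exists (fun x => x - entry x 0 *: v); split.
- have := bop_sub (@bop_id R) (bop_rank1 e0 v); congr bounded_operator.
  by apply/funext => x; rewrite dot_e0.
- move=> x; rewrite e; apply: ell2P => n; rewrite !entryE !entry_vvec.
  have -> : (vseq R 0)%:C = 0 :> C by [].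
  ring.
- move=> x; rewrite e; apply: ell2P => n; rewrite !entryE !entry_vvec.
  have -> : (vseq R 0)%:C = 0 :> C by [].
  ring.
Qed.

(** Because u_0 = v_0 = 0, the entry 0 of any value is x_0 - x_0 = 0, so e_0 is not attained. *)
Lemma kernel_not_hyp_invertible : ~ hyp_invertible (@kernel_family R).
Proof.
move=> /(hyp_invertible_family (@bop_kernel1 R) (@bop_kernel2 R) (erefl (limit_op 0))).
move=> [S [_ _ /(_ e0)/(congr1 (fun w : H => entry w 0))]].
set x := S e0; have du : dot (entry x 0 *: e0) u = 0.
  by apply: dot_u_tail0 => n n0; rewrite entryZ entry_e0 (negPf n0) mulr0.
rewrite du dot_e0 !entryE !entry_e0 entry_vvec /=.
have -> : (vseq R 0)%:C = 0 :> C by [].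
rewrite ?(mul0r, mulr0, mulr1, oppr0, addr0, subr0) subrr => /eqP.
by rewrite eq_sym oner_eq0.
Qed.

End Hypotheses.

Theorem proposition7p1 (R : realType) :
  (exists (H : hilbertSpace R) (D : set R[i]%C) (A : R[i]%C -> H -> H),
     [/\ separable H, fredholm_family D A,
         [/\ ~ hyp_compact D A, hyp_selfadjoint A & hyp_invertible A],
         ~ concl_small_domains D A & ~ concl_sectors D A]) /\
  (exists (H : hilbertSpace R) (D : set R[i]%C) (A : R[i]%C -> H -> H),
     [/\ separable H, fredholm_family D A,
         [/\ hyp_compact D A, ~ hyp_selfadjoint A & hyp_invertible A],
         ~ concl_small_domains D A & ~ concl_sectors D A]) /\
  (exists (H : hilbertSpace R) (D : set R[i]%C) (A : R[i]%C -> H -> H),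
     [/\ separable H, fredholm_family D A,
         [/\ hyp_compact D A, hyp_selfadjoint A & ~ hyp_invertible A],
         ~ concl_small_domains D A & ~ concl_sectors D A]).
Proof.
have Re1 : 0 < complex.Re (1 : R[i]) by exact: ltr01.
split; [|split]; exists (ell2_hilbert R), setT.
- have A0 : shift_family 0 = limit_op 0 :> (ell2_hilbert R -> _) by exact: op_family0.
  exists (@shift_family R); split.
  + exact: ell2_separable.
  + apply: family_fredholm; [exact: bop_limit_op|exact: bop_shift1|exact: bop0| |].
      exact: shift_fredholm.
    exact: shift_invertible.
  + split; [exact: shift_not_compact| |exact: shift_hyp_invertible].
    by rewrite /hyp_selfadjoint A0; exact: limit_op0_selfadjoint.
  + apply: not_small_domains => [z|l l0 ln|n n0]; first exact: shift_invertible.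
      by rewrite A0; exact: limit_op_mult0.
    by rewrite A0; exact: limit_op_mult.
  + apply: not_sectors => [z|l l0 ln|n n0]; first exact: shift_invertible.
      by rewrite A0; exact: limit_op_mult0.
    by rewrite A0; exact: limit_op_mult.
- have A0 : nilpotent_family 0 = limit_op 1 :> (ell2_hilbert R -> _) by exact: op_family0.
  exists (@nilpotent_family R); split.
  + exact: ell2_separable.
  + apply: family_fredholm; [exact: bop_limit_op|exact: bop_nilpotent1|exact: bop0| |].
      exact: nilpotent_fredholm.
    exact: nilpotent_invertible.
  + split; [exact: nilpotent_compact| |exact: nilpotent_hyp_invertible].
    by rewrite /hyp_selfadjoint A0; exact: limit_op1_not_selfadjoint.
  + apply: not_small_domains => [z|l l0 ln|n n0]; first exact: nilpotent_invertible.
      by rewrite A0; exact: limit_op_mult0.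
    by rewrite A0; exact: limit_op_mult.
  + apply: not_sectors => [z|l l0 ln|n n0]; first exact: nilpotent_invertible.
      by rewrite A0; exact: limit_op_mult0.
    by rewrite A0; exact: limit_op_mult.
- have A0 : kernel_family 0 = limit_op 0 :> (ell2_hilbert R -> _) by exact: op_family0.
  exists (@kernel_family R); split.
  + exact: ell2_separable.
  + apply: family_fredholm; [exact: bop_limit_op|exact: bop_kernel1|exact: bop_kernel2| |].
      exact: kernel_fredholm.
    exact: kernel_invertible.
  + split; [exact: kernel_compact| |exact: kernel_not_hyp_invertible].
    by rewrite /hyp_selfadjoint A0; exact: limit_op0_selfadjoint.
  + apply: not_small_domains => [z|l l0 ln|n n0]; first exact: kernel_invertible.
      by rewrite A0; exact: limit_op_mult0.
    by rewrite A0; exact: limit_op_mult.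
  + apply: not_sectors => [z|l l0 ln|n n0]; first exact: kernel_invertible.
      by rewrite A0; exact: limit_op_mult0.
    by rewrite A0; exact: limit_op_mult.
Qed.
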